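(* Let $R$ be a ring. Then the following assertions are equivalent: (1) any finitely generated left $R$-module is $\mathcal F_1^{\mathrm{fp}}$-flat; (2) any left $R$-module is $\mathcal F_1^{\mathrm{fp}}$-flat; (3) any injective left $R$-module is $\mathcal F_1^{\mathrm{fp}}$-flat; (4) any quotient of an $\mathcal F_1^{\mathrm{fp}}$-flat left $R$-module is $\mathcal F_1^{\mathrm{fp}}$-flat; (5) $R$ is right $\mathcal F_1^{\mathrm{fp}}$-coherent and $\mathrm{E}(S)$ is $\mathcal F_1^{\mathrm{fp}}$-flat for each simple left $R$-module $S$; (6) any element of $\mathcal F_1^{\mathrm{fp}}$ is projective.
   Context: $R$ is an associative ring with unit and modules are unital. $\mathcal F_1^{\mathrm{fp}}$ is the class of finitely presented right $R$-modules of flat dimension at most $1$. A left $R$-module $M$ is $\mathcal F_1^{\mathrm{fp}}$-flat if $\mathrm{Tor}_1^R(H,M)=0$ for every $H\in\mathcal F_1^{\mathrm{fp}}$. $R$ is right $\mathcal F_1^{\mathrm{fp}}$-coherent if every finitely generated flat right submodule of a free right $R$-module is finitely presented (and thus projective). $\mathrm{E}(M)$ denotes the injective envelope of $M$. *)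

(* Defs.v *)
From HB Require Import structures.
From mathcomp Require Import all_boot all_algebra.
From mathcomp Require Import boolp.
From mathcomp.multinomials Require Import freeg.

Set Implicit Arguments.
Unset Strict Implicit.
Unset Printing Implicit Defensive.

Import GRing.Theory.
Local Open Scope ring_scope.
Local Open Scope quotient_scope.

(* A left R-module is an [lmodType R]; a right R-module is an [lmodType R^c],
   where R^c is the converse ring, so that [r *: h] reads h r in a right
   R-module H. Sections about modules over a ring S are used both with S := R
   and with S := R^c. The ring may be trivial. *)

Definition surjective (A B : Type) (f : A -> B) : Prop :=
  forall y, exists x, f x = y.

Definition exact_at (A B C : zmodType) (f : A -> B) (g : B -> C) : Prop :=
  forall y, g y = 0 <-> exists x, f x = y.

Section Modules.
Variable S : pzRingType.
Implicit Types M : lmodType S.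

Definition finitely_generated M : Prop :=
  exists (n : nat) (x : 'I_n -> M),
    forall y : M, exists c : 'I_n -> S, y = \sum_(i < n) c i *: x i.

Definition finitely_presented M : Prop :=
  exists (m n : nat) (f : {linear 'rV[S]_m -> 'rV[S]_n})
         (g : {linear 'rV[S]_n -> M}),
    surjective g /\ exact_at f g.

Definition is_basis M (B : M -> Prop) : Prop :=
  (forall x : M, exists (s : seq M) (c : M -> S),
     (forall b, b \in s -> B b) /\ x = \sum_(b <- s) c b *: b) /\
  (forall (s : seq M) (c : M -> S), uniq s -> (forall b, b \in s -> B b) ->
     \sum_(b <- s) c b *: b = 0 -> forall b, b \in s -> c b = 0).

Definition free_module M : Prop := exists B : M -> Prop, is_basis B.

Definition projective_module M : Prop :=
  forall (A B : lmodType S) (p : {linear A -> B}) (f : {linear M -> B}),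
    surjective p -> exists g : {linear M -> A}, forall x, p (g x) = f x.

Definition injective_module M : Prop :=
  forall (A B : lmodType S) (i : {linear A -> B}) (f : {linear A -> M}),
    injective i -> exists g : {linear B -> M}, forall x, g (i x) = f x.

Definition simple_module M : Prop :=
  (exists x : M, x != 0) /\
  forall A : {pred M}, submod_closed A ->
    (forall x, x \in A -> x = 0) \/ (forall x, x \in A).

Definition essential M (E : lmodType S) (i : M -> E) : Prop :=
  forall A : {pred E}, submod_closed A ->
    (forall x, i x \in A -> i x = 0) -> forall y, y \in A -> y = 0.

Definition injective_envelope M (E : lmodType S) (i : {linear M -> E}) : Prop :=
  [/\ injective_module E, injective i & essential i].

Record projective_resolution M := ProjectiveResolution {
  res_obj : nat -> lmodType S;
  res_d : forall n, {linear res_obj n.+1 -> res_obj n};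
  res_aug : {linear res_obj 0 -> M};
  res_projective : forall n, projective_module (res_obj n);
  res_aug_surj : surjective res_aug;
  res_exact0 : exact_at (res_d 0) res_aug;
  res_exact : forall n, exact_at (res_d n.+1) (res_d n) }.

End Modules.

Section Tensor.
Variables (R : pzRingType) (H : lmodType R^c) (M : lmodType R).

Inductive tensor_rel : {freeg (H * M)%type} -> Prop :=
| TensorRelDl h h' m :
    tensor_rel (<< (h + h', m) >> - (<< (h, m) >> + << (h', m) >>))
| TensorRelDr h m m' :
    tensor_rel (<< (h, m + m') >> - (<< (h, m) >> + << (h, m') >>))
| TensorRelZ (r : R) h m :
    tensor_rel (<< ((r : R^c) *: h, m) >> - << (h, r *: m) >>)
| TensorRel0 : tensor_rel 0
| TensorRelB x y : tensor_rel x -> tensor_rel y -> tensor_rel (x - y).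

Definition tensor_relb (x : {freeg (H * M)%type}) : bool := `[< tensor_rel x >].

Lemma tensor_relb_closed : zmod_closed tensor_relb.
Proof.
split=> [|x y]; first exact/asboolP/TensorRel0.
by move=> /asboolP hx /asboolP hy; apply/asboolP; apply: TensorRelB.
Qed.

HB.instance Definition _ :=
  GRing.isZmodClosed.Build {freeg (H * M)%type} tensor_relb tensor_relb_closed.

Definition tensor_sub : zmodClosed {freeg (H * M)%type} :=
  GRing.ZmodClosed.clone _ tensor_relb _.

Definition tensor : zmodType := Quotient.quot tensor_sub.

Definition tens (h : H) (m : M) : tensor :=
  \pi_(Quotient.quot tensor_sub) << (h, m) >>.

Definition balanced (A : zmodType) (b : H -> M -> A) : Prop :=
  [/\ forall h h' m, b (h + h') m = b h m + b h' m,
      forall h m m', b h (m + m') = b h m + b h m'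
    & forall (r : R) h m, b ((r : R^c) *: h) m = b h (r *: m)].

Definition tensor_lift (A : zmodType) (b : H -> M -> A) (x : tensor) : A :=
  fglift (fun p : H * M => b p.1 p.2 : zmodule A)
         (repr (x : Quotient.quot tensor_sub)).

Lemma tensDl h h' m : tens (h + h') m = tens h m + tens h' m.
Proof.
rewrite /tens -raddfD; apply/eqP.
by rewrite -Quotient.idealrBE; apply/asboolP/TensorRelDl.
Qed.

Lemma tensDr h m m' : tens h (m + m') = tens h m + tens h m'.
Proof.
rewrite /tens -raddfD; apply/eqP.
by rewrite -Quotient.idealrBE; apply/asboolP/TensorRelDr.
Qed.

Lemma tensZ (r : R) h m : tens ((r : R^c) *: h) m = tens h (r *: m).
Proof.
by apply/eqP; rewrite -Quotient.idealrBE; apply/asboolP/TensorRelZ.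
Qed.

Lemma tens_balanced : balanced tens.
Proof. by split; [exact: tensDl | exact: tensDr | exact: tensZ]. Qed.

Section Lift.
Variables (A : zmodType) (b : H -> M -> A) (bb : balanced b).

Let l : {freeg (H * M)%type} -> A :=
  fglift (fun p : H * M => b p.1 p.2 : zmodule A).

Let lB : {morph l : x y / x - y}.
Proof. by move=> x y; exact: (lift_is_additive (M := zmodule A)). Qed.

Let l0 : l 0 = 0. Proof. by have := lB 0 0; rewrite !subrr. Qed.

Let lD : {morph l : x y / x + y}.
Proof.
move=> x y; have lN : l (- y) = - l y by have := lB 0 y; rewrite l0 !sub0r.
by have := lB x (- y); rewrite lN !opprK.
Qed.

Let lU h m : l << (h, m) >> = b h m.
Proof. by rewrite /l liftU scale1r. Qed.

Let l_rel x : tensor_rel x -> l x = 0.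
Proof.
case: bb => bDl bDr bZ; elim=> {x} [h h' m|h m m'|r h m||x y _ x0 _ y0].
- by rewrite lB lD !lU bDl subrr.
- by rewrite lB lD !lU bDr subrr.
- by rewrite lB !lU bZ subrr.
- exact: l0.
- by rewrite lB x0 y0 subrr.
Qed.

Let l_pi x : tensor_lift b (\pi_(Quotient.quot tensor_sub) x) = l x.
Proof.
rewrite /tensor_lift -/l; set y := repr _.
have: y - x \in tensor_relb by rewrite Quotient.idealrBE /y reprK.
by move=> /asboolP/l_rel; rewrite lB => /subr0_eq.
Qed.

Lemma tensor_lift_tens h m : tensor_lift b (tens h m) = b h m.
Proof. by rewrite l_pi lU. Qed.

Lemma tensor_lift_zmod_morphism : zmod_morphism (tensor_lift b).
Proof.
elim/quotW=> x; elim/quotW=> y.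
by rewrite -raddfB !l_pi lB.
Qed.

End Lift.

Lemma tensor_ind (P : tensor -> Prop) :
  (forall h m, P (tens h m)) -> (forall x y, P x -> P y -> P (x - y)) ->
  forall x, P x.
Proof.
move=> Pt PB.
have P0 : P 0 by rewrite -(subrr (tens 0 0)); apply: PB; apply: Pt.
have PN x : P x -> P (- x) by rewrite -sub0r; apply: PB.
have PD x y : P x -> P y -> P (x + y).
  by move=> Px Py; rewrite -[y]opprK; apply/PB/PN.
elim/quotW=> x; rewrite -(freeg_sumE x) raddf_sum.
elim/big_ind: _ => [||p _]; [exact: P0 | exact: PD |].
have Pn (n : nat) : P (tens p.1 p.2 *+ n).
  by elim: n => [|n IH]; rewrite ?mulr0n // mulrS; apply: PD.
have -> : << (coeff p x) *g p >> = << p >> *~ (coeff p x) :> {freeg (H * M)%type}.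
  by rewrite freeg_mulz intz.
rewrite raddfMz; case: p Pn => h m /= Pn.
by case: (coeff _ _) => n; [apply: Pn | apply/PN/Pn].
Qed.

End Tensor.

Section TensorMap.
Variables (R : pzRingType) (H H' : lmodType R^c) (M M' : lmodType R).
Variables (f : {linear H -> H'}) (g : {linear M -> M'}).

Definition tensor_map : tensor H M -> tensor H' M' :=
  tensor_lift (fun h m => tens (f h) (g m)).

Let map_balanced : balanced (fun h m => tens (f h) (g m)).
Proof.
split=> [h h' m|h m m'|r h m].
- by rewrite linearD tensDl.
- by rewrite linearD tensDr.
- by rewrite !linearZ tensZ.
Qed.

Lemma tensor_mapE h m : tensor_map (tens h m) = tens (f h) (g m).
Proof. exact: tensor_lift_tens map_balanced h m. Qed.

Lemma tensor_map_zmod_morphism : zmod_morphism tensor_map.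
Proof. exact: tensor_lift_zmod_morphism map_balanced. Qed.

HB.instance Definition _ := GRing.isZmodMorphism.Build (tensor H M)
  (tensor H' M') tensor_map tensor_map_zmod_morphism.

End TensorMap.

Section F1fp.
Variable R : pzRingType.

Definition flat (H : lmodType R^c) : Prop :=
  forall (M N : lmodType R) (f : {linear M -> N}),
    injective f -> injective (tensor_map (@idfun H) f).

Definition flat_dim_le1 (H : lmodType R^c) : Prop :=
  exists (F1 F0 : lmodType R^c) (i : {linear F1 -> F0}) (p : {linear F0 -> H}),
    [/\ flat F1, flat F0, injective i, exact_at i p & surjective p].

(* Tor_1(H, M) is the homology of P (x) M at P_1 (x) M for a projective
   resolution P of H; up to isomorphism it does not depend on P. *)
Definition Tor1_eq0 (H : lmodType R^c) (M : lmodType R) : Prop :=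
  forall P : projective_resolution H,
    exact_at (tensor_map (res_d P 1) (@idfun M))
             (tensor_map (res_d P 0) (@idfun M)).

Definition F1fp (H : lmodType R^c) : Prop :=
  finitely_presented H /\ flat_dim_le1 H.

Definition F1fp_flat (M : lmodType R) : Prop :=
  forall H : lmodType R^c, F1fp H -> Tor1_eq0 H M.

End F1fp.

Definition right_F1fp_coherent (R : pzRingType) : Prop :=
  forall (F K : lmodType R^c) (i : {linear K -> F}),
    free_module F -> injective i -> finitely_generated K -> flat K ->
    finitely_presented K.

(* Main.v *)
(* Let 0 -> K -> R^n -> H -> 0 with H in F_1^fp; then K is finitely generated and
   flat, and Tor_1(H, M) is the kernel of K (x) M -> R^n (x) M.

   If this kernel vanishes for all M = R^m / N, testing it on the M presented by the
   coordinates of the generators of K splits K -> R^n (Villamayor), so H is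
   projective; this covers (1) and (4).  As K is flat, Tor_1(H, M) embeds in
   Tor_1(H, E) whenever M embeds in E, which reduces (3) to (1).  Under (5), K is
   moreover projective, and a nonzero cokernel of (R^n)^* -> K^* would produce a
   simple S with Tor_1(H, E(S)) nonzero, so K -> R^n splits again.

   Tensor products are tested by characters: by injectivity of Q/Z, u (x) v is
   injective iff every balanced Q/Z-valued map extends along (u, v).  In these
   terms flatness of H is injectivity of its character module, which gives the
   flatness of kernels and, through duals of projectives, enough injectives. *)

From HB Require Import structures.
Require Import Defs.
From mathcomp Require Import all_boot all_order all_algebra.
From mathcomp Require Import boolp classical_sets functions.

Set Implicit Arguments.
Unset Strict Implicit.
Unset Printing Implicit Defensive.

Import Order.TTheory GRing.Theory Num.Theory.
Local Open Scope ring_scope.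

(** * Submodules and quotients *)

Lemma zmod_morphism0 (A B : zmodType) (f : A -> B) : zmod_morphism f -> f 0 = 0.
Proof. by move=> fB; rewrite -(subrr 0) fB subrr. Qed.

Lemma zmod_morphismN (A B : zmodType) (f : A -> B) :
  zmod_morphism f -> {morph f : x / - x}.
Proof. by move=> fB x; rewrite -sub0r fB (zmod_morphism0 fB) sub0r. Qed.

Lemma zmod_morphismD (A B : zmodType) (f : A -> B) :
  zmod_morphism f -> {morph f : x y / x + y}.
Proof. by move=> fB x y; rewrite -[y]opprK fB !(zmod_morphismN fB) !opprK. Qed.

Lemma zmod_morphism_sum (A B : zmodType) (f : A -> B) (I : Type) (r : seq I)
    (F : I -> A) : zmod_morphism f ->
  f (\sum_(i <- r) F i) = \sum_(i <- r) f (F i).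
Proof.
move=> fB; apply: (big_morph f); [exact: zmod_morphismD | exact: zmod_morphism0].
Qed.

Lemma additive_zmod_morphism (A B : zmodType) (f : A -> B) :
  {morph f : x y / x + y} -> zmod_morphism f.
Proof.
move=> fD; have f0 : f 0 = 0 by apply: (addIr (f 0)); rewrite -fD !add0r.
by move=> x y; rewrite fD; congr (_ + _); apply: (addrI (f y)); rewrite -fD !subrr.
Qed.

Lemma linear_exists (S : pzRingType) (M N : lmodType S) (f : M -> N) :
  (forall a, {morph f : x y / a *: x + y}) -> exists g : {linear M -> N}, g =1 f.
Proof.
move=> fL; have fS : linear f by [].
pose g0 := GRing.isLinear.Build S M N *:%R f fS.
pose g : {linear M -> N} := HB.pack f g0.
by exists g.
Qed.

Lemma inj_eq0 (A B : zmodType) (f : A -> B) : zmod_morphism f ->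
  (forall x, f x = 0 -> x = 0) -> injective f.
Proof. by move=> fB f0 x y fxy; apply/subr0_eq/f0; rewrite fB fxy subrr. Qed.

Section Submodule.
Variables (S : pzRingType) (M : lmodType S) (A : {pred M}) (clA : submod_closed A).

(** The closure proof is kept inside the term so that the algebraic instances on [submod_pred] can
    be recovered from the predicate. *)
Definition submod_pred : {pred M} := let _ := clA in A.

HB.instance Definition _ := GRing.isSubmodClosed.Build S M submod_pred clA.

Definition submodule := {x : M | x \in submod_pred}.

HB.instance Definition _ := SubChoice.on submodule.
HB.instance Definition _ := [SubChoice_isSubLmodule of submodule by <:].

Definition subincl (x : submodule) : M := val x.

Lemma subincl_linear : linear subincl.
Proof. by []. Qed.

HB.instance Definition _ :=
  GRing.isLinear.Build S submodule M *:%R subincl subincl_linear.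

Lemma subincl_inj : injective subincl.
Proof. exact: val_inj. Qed.

Lemma subinclP x : subincl x \in A.
Proof. exact: (valP x). Qed.

Lemma subincl_surj y : y \in A -> exists x, subincl x = y.
Proof. by move=> Ay; exists (Sub y Ay : submodule); rewrite /subincl SubK. Qed.

End Submodule.

Section QuotientModule.
Variables (S : pzRingType) (M : lmodType S) (A : {pred M}) (clA : submod_closed A).

Local Notation Q0 := (Quotient.quot (submod_pred clA)).

Definition quomod : Type := Q0.
HB.instance Definition _ := GRing.Zmodule.on quomod.

Definition quoproj (x : M) : quomod := \pi_Q0%qT x.

Let quoprojB : {morph quoproj : x y / x - y}.
Proof. exact: raddfB. Qed.

Lemma quoproj_eq0 x : quoproj x = 0 <-> x \in A.
Proof.
rewrite -[in x \in A](subr0 x).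
have -> : (x - 0 \in A) = (quoproj x == quoproj 0 :> Q0).
  by rewrite -Quotient.idealrBE.
rewrite -(subrr (quoproj 0)) -quoprojB subrr.
by split=> [/eqP|/eqP].
Qed.

Lemma quoproj_surj : surjective quoproj.
Proof. by move=> y; exists (repr (y : Q0)); rewrite /quoproj reprK. Qed.

Let rep (y : quomod) : M := repr (y : Q0).
Let repK y : quoproj (rep y) = y. Proof. exact: reprK. Qed.

Definition quoscale (a : S) (y : quomod) : quomod := quoproj (a *: repr (y : Q0)).

Let quoprojZ a x : quoscale a (quoproj x) = quoproj (a *: x).
Proof.
apply/subr0_eq; rewrite -quoprojB -scalerBr; apply/quoproj_eq0.
rewrite -[_ *: _]addr0; apply clA.2; last exact: clA.1.
by apply/quoproj_eq0; rewrite quoprojB [X in X - _]repK subrr.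
Qed.

Let quoprojD : {morph quoproj : x y / x + y}.
Proof. exact: raddfD. Qed.

Fact quoscaleA a b y : quoscale a (quoscale b y) = quoscale (a * b) y.
Proof. by rewrite -(repK y) !quoprojZ scalerA. Qed.
Fact quoscale1 : left_id 1 quoscale.
Proof. by move=> y; rewrite -(repK y) quoprojZ scale1r. Qed.
Fact quoscaleDr : right_distributive quoscale +%R.
Proof.
by move=> a y z; rewrite -(repK y) -(repK z) -quoprojD !quoprojZ scalerDr quoprojD.
Qed.
Fact quoscaleDl y : {morph quoscale^~ y : a b / a + b}.
Proof. by move=> a b; rewrite -(repK y) !quoprojZ scalerDl quoprojD. Qed.

HB.instance Definition _ := GRing.Zmodule_isLmodule.Build S quomod
  quoscaleA quoscale1 quoscaleDr quoscaleDl.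

Lemma quoproj_linear : linear quoproj.
Proof. by move=> a x y; rewrite quoprojD -quoprojZ. Qed.

HB.instance Definition _ :=
  GRing.isLinear.Build S M quomod *:%R quoproj quoproj_linear.

End QuotientModule.

Section Factor.
Variables (S : pzRingType).
Implicit Types A B C : lmodType S.

Lemma factor_inj A B C (i : {linear B -> C}) (f : {linear A -> C}) :
  injective i -> (forall x, exists y, i y = f x) ->
  exists g : {linear A -> B}, forall x, i (g x) = f x.
Proof.
move=> ii /choice[g gE].
have [|h hE] := @linear_exists _ _ _ g.
  by move=> a x y; apply: ii; rewrite linearP !gE linearP.
by exists h => x; rewrite hE.
Qed.

Lemma factor_surj A B C (p : {linear A -> B}) (f : {linear A -> C}) :
  surjective p -> (forall x, p x = 0 -> f x = 0) ->
  exists g : {linear B -> C}, forall x, g (p x) = f x.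
Proof.
move=> /choice[s sE] pf.
have fs x : f (s (p x)) = f x.
  by apply/subr0_eq; rewrite -linearB; apply: pf; rewrite linearB sE subrr.
have [|h hE] := @linear_exists _ _ _ (f \o s).
  move=> a x y /=; rewrite -linearP; apply/subr0_eq.
  by rewrite -linearB pf // linearB linearP !sE subrr.
by exists h => x; rewrite hE /= fs.
Qed.

Lemma kernel_closed A B (f : {linear A -> B}) :
  submod_closed [pred x | f x == 0].
Proof.
split=> [|a x y]; first by rewrite !inE linear0.
by rewrite !inE linearP => /eqP-> /eqP->; rewrite scaler0 addr0.
Qed.

Lemma range_closed A B (f : {linear A -> B}) :
  submod_closed [pred y | `[< exists x, f x = y >]].
Proof.
split=> [|a x y]; first by apply/asboolP; exists 0; rewrite linear0.
move=> /asboolP[u <-] /asboolP[v <-]; apply/asboolP.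
by exists (a *: u + v); rewrite linearP.
Qed.

Definition kerincl A B (f : {linear A -> B}) : {linear submodule (kernel_closed f) -> A} :=
  @subincl S A _ (kernel_closed f).

Lemma kerincl_inj A B (f : {linear A -> B}) : injective (kerincl f).
Proof. exact: subincl_inj. Qed.

Lemma kerincl_exact A B (f : {linear A -> B}) : exact_at (kerincl f) f.
Proof.
move=> y; split=> [fy|[x <-]]; last exact/eqP/(subinclP x).
by have [|x xE] := @subincl_surj S A _ (kernel_closed f) y;
  [apply/eqP | exists x].
Qed.

(** Both [d] and [f] land in the kernel of [e], and [d] maps onto it by exactness, so projectivity
    of [P] applies there. *)
Lemma projective_lift_exact A B C (P : lmodType S) (d : {linear A -> B})
    (e : {linear B -> C}) (f : {linear P -> B}) :
  projective_module P -> exact_at d e -> (forall x, e (f x) = 0) ->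
  exists g : {linear P -> A}, forall x, d (g x) = f x.
Proof.
move=> Pp de ef.
have [|d' d'E] := factor_inj (f := d) (@kerincl_inj _ _ e).
  by move=> x; apply/(kerincl_exact e)/de; exists x.
have [|f' f'E] := factor_inj (f := f) (@kerincl_inj _ _ e).
  by move=> x; apply/(kerincl_exact e).
have [|g gE] := Pp _ _ d' f'.
  move=> y; have /de[x xE] : e (kerincl e y) = 0 by apply/kerincl_exact; exists y.
  by exists x; apply: (@kerincl_inj _ _ e); rewrite d'E.
by exists g => x; rewrite -d'E gE.
Qed.

Lemma projective_section (H P : lmodType S) (p : {linear P -> H}) :
  projective_module H -> surjective p ->
  exists s : {linear H -> P}, cancel s p.
Proof. by move=> /(_ _ _ p idfun)/[apply] -[s]; exists s. Qed.

Lemma projective_retract (P Q : lmodType S) (s : {linear P -> Q})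
    (r : {linear Q -> P}) :
  cancel s r -> projective_module Q -> projective_module P.
Proof.
move=> sr Qp A B p f /(Qp _ _ p (f \o r : {linear Q -> B}))[g gE].
by exists (g \o s : {linear P -> A}) => x; rewrite /= gE /= sr.
Qed.

Lemma injective_retract (P Q : lmodType S) (s : {linear P -> Q})
    (r : {linear Q -> P}) :
  cancel s r -> injective_module Q -> injective_module P.
Proof.
move=> sr Qi A B i f /(Qi _ _ i (s \o f : {linear A -> Q}))[g gE].
by exists (r \o g : {linear B -> P}) => x; rewrite /= gE /= sr.
Qed.

End Factor.

(** * Maximal submodules and the injectivity of Q/Z *)

Definition submod_set (S : pzRingType) (M : lmodType S) (L : M -> Prop) :=
  L 0 /\ forall a x y, L x -> L y -> L (a *: x + y).

Lemma submod_setP (S : pzRingType) (M : lmodType S) (L : M -> Prop) :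
  submod_set L -> submod_closed [pred x | `[< L x >]].
Proof.
case=> L0 LP; split=> [|a x y /asboolP Lx /asboolP Ly]; apply/asboolP => //.
exact: LP.
Qed.

Lemma maximal_avoiding (S : pzRingType) (M : lmodType S) (A X : M -> Prop) :
  submod_set A -> (forall x, A x -> ~ X x) ->
  exists L : M -> Prop, [/\ submod_set L, forall x, A x -> L x,
    forall x, L x -> ~ X x &
    forall L' : M -> Prop, submod_set L' -> (forall x, L x -> L' x) ->
      (forall x, L' x -> ~ X x) -> forall x, L' x -> L x].
Proof.
move=> sA AX.
pose P (L : set M) := (forall x, ~ L x) \/
  [/\ submod_set L, forall x, A x -> L x & forall x, L x -> ~ X x].
have [F FP Ftot|L [PL Lmax]] := @Zorn_bigcup M P.
  have [[L0 FL0 [z L0z]]|noF] := pselect (exists2 L, F L & exists x, L x); last first.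
    by left=> x [L FL Lx]; apply: noF; exists L => //; exists x.
  have FPn L x : F L -> L x ->
      [/\ submod_set L, forall x, A x -> L x & forall x, L x -> ~ X x].
    by move=> /FP[/(_ x)//|].
  have [[L00 _] AL0 _] := FPn _ _ FL0 L0z.
  right; split=> [|x /AL0|x [L FL Lx]]; [split=> [|a x y] | by exists L0 |].
  - by exists L0.
  - move=> [L1 F1 L1x] [L2 F2 L2y].
    have [L12|L21] := Ftot _ _ F1 F2.
      by exists L2 => //; have [[_ +] _ _] := FPn _ _ F2 L2y; apply => //; apply: L12.
    by exists L1 => //; have [[_ +] _ _] := FPn _ _ F1 L1x; apply => //; apply: L21.
  - by have [_ _] := FPn _ _ FL Lx; apply.
have LP : [/\ submod_set L, forall x, A x -> L x & forall x, L x -> ~ X x].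
  case: PL => // L0; case: (Lmax A); last by right.
  by split=> [x /L0 //|AL]; apply: (L0 0); apply: AL; apply sA.1.
have [sL AL LX] := LP; exists L; split=> // L' sL' LL' L'X x L'x.
apply: contrapT => Lx; apply: (Lmax L'); first by split=> // /(_ _ L'x).
by right; split=> // y /AL/LL'.
Qed.

Definition integral (x : rat) : bool := x \is a Num.int.

Lemma integral_closed : zmod_closed integral.
Proof.
by split=> [|x y]; [exact: rpred0 | exact: rpredB].
Qed.

HB.instance Definition _ := GRing.isZmodClosed.Build rat integral integral_closed.

Definition integral_sub : zmodClosed rat := GRing.ZmodClosed.clone _ integral _.

Definition QZ : Type := Quotient.quot integral_sub.
HB.instance Definition _ := GRing.Zmodule.on QZ.

Definition toQZ (x : rat) : QZ := (\pi_(Quotient.quot integral_sub) x)%qT.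

Lemma toQZB : {morph toQZ : x y / x - y}.
Proof. exact: raddfB. Qed.

HB.instance Definition _ := GRing.isZmodMorphism.Build rat QZ toQZ toQZB.

Lemma toQZ_eq0 x : toQZ x = 0 <-> x \is a Num.int.
Proof.
have -> : (x \is a Num.int) = (toQZ x == toQZ 0 :> Quotient.quot integral_sub).
  by rewrite -Quotient.idealrBE subr0.
by rewrite -(subrr (toQZ 0)) -toQZB subrr; split=> [/eqP|/eqP].
Qed.

Lemma toQZMz (y : rat) (m : int) : toQZ (y *~ m) = toQZ y *~ m.
Proof. exact: (raddfMz (toQZ : {additive rat -> QZ})). Qed.

Lemma QZ_divisible (d : QZ) (n : int) : n != 0 -> exists e : QZ, e *~ n = d.
Proof.
move=> n0; pose x : rat := repr (d : Quotient.quot integral_sub).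
have xd : toQZ x = d by exact: reprK.
exists (toQZ (x / n%:~R)); rewrite -toQZMz -mulrzr divfK //.
by rewrite intr_eq0.
Qed.

(** The class of 1/n is killed by [n] and is nonzero unless [n] is a unit; for [n = 0] everything is
    killed and the class of 1/2 will do. *)
Lemma QZ_torsion (n : int) : `|n|%N != 1%N -> exists2 e : QZ, e <> 0 & e *~ n = 0.
Proof.
move=> n1; have [->|n0] := eqVneq n 0.
  by exists (toQZ (1 / 2%:R)) => [/toQZ_eq0|]; rewrite ?mulr0z.
exists (toQZ n%:~R^-1) => [/toQZ_eq0/intrP[m nm]|].
  have: (m * n)%:~R = 1 :> rat by rewrite intrM -nm mulVf ?intr_eq0.
  move=> /(congr1 (fun x => numq x)); rewrite numq_int (_ : 1 = 1%:~R) // numq_int.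
  move=> /(congr1 absz); rewrite abszM => /eqP; rewrite muln_eq1.
  by rewrite (negPf n1) andbF.
by rewrite -toQZMz -mulrzr mulVf ?intr_eq0 //; apply/toQZ_eq0.
Qed.

Lemma int_subgroup_generator (D : int -> Prop) :
  D 0 -> (forall m n, D m -> D n -> D (m - n)) ->
  exists2 k, D k & forall n, D n -> exists q, n = k * q.
Proof.
move=> D0 DB.
have DN n : D n -> D (- n) by rewrite -sub0r; apply: DB.
have DM n (q : int) : D n -> D (n * q).
  move=> Dn; have Dnat (j : nat) : D (n * j%:Z).
    elim: j => [|j IH]; first by rewrite mulr0.
    by rewrite intS mulrDr mulr1 -[n * j]opprK; apply/DB/DN.
  by case: q => j; rewrite ?NegzE ?mulrN; [|apply: DN]; apply: Dnat.
have [noD|] := pselect (forall n, D n -> n = 0).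
  by exists 0 => // n /noD->; exists 0; rewrite mulr0.
move=> /existsNP[n0 /not_implyP[Dn0 /eqP n0_neq0]].
have exk : exists k : nat, (0 < k)%N && `[< D k%:Z >].
  exists `|n0|%N; rewrite absz_gt0 n0_neq0; apply/asboolP.
  by rewrite abszE; case: (ger0P n0) => _ //; apply: DN.
case: (ex_minnP exk) => k /andP[k0 /asboolP Dk] kmin.
exists k%:Z => // n Dn; exists (n %/ k%:Z)%Z.
rewrite mulrC [LHS](divz_eq n k).
suff -> : (n %% k)%Z = 0 by rewrite addr0.
have Dm : D (n %% k)%Z.
  rewrite /modz mulrC; apply: DB => //; exact: DM.
have := modz_ge0 n (lt0r_neq0 (k0 : 0 < k%:Z)); have := ltz_pmod n (k0 : 0 < k%:Z).
case: (n %% k)%Z Dm => // -[//|j] Dj jk _.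
by have := kmin j.+1 (introT (asboolP _) Dj); rewrite leqNgt -ltz_nat jk.
Qed.

Lemma zmod_closed_mulrz (V : zmodType) (L : V -> Prop) :
  L 0 -> (forall x y, L x -> L y -> L (x - y)) ->
  forall x (n : int), L x -> L (x *~ n).
Proof.
move=> L0 LB x n Lx.
have LN y : L y -> L (- y) by rewrite -sub0r; apply: LB.
have Ln (j : nat) : L (x *+ j).
  by elim: j => [|j IH]; rewrite ?mulr0n // mulrS -[x *+ j]opprK; apply/LB/LN.
by case: n => j; rewrite ?NegzE ?mulrNz; [|apply: LN]; apply: Ln.
Qed.

(* A maximal functional graph is total because QZ is divisible. *)
Lemma character_extension (V : zmodType) (G : V -> QZ -> Prop) :
  G 0 0 -> (forall x y d e, G x d -> G y e -> G (x - y) (d - e)) ->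
  (forall d, G 0 d -> d = 0) ->
  exists2 chi : V -> QZ, zmod_morphism chi & forall x d, G x d -> chi x = d.
Proof.
move=> G0 GB Gfun; pose W := zmodule (V * QZ)%type.
have sub_set (L : W -> Prop) : L 0 -> (forall x y, L x -> L y -> L (x - y)) ->
    submod_set L.
  move=> L0 LB; split=> // a x y Lx Ly; rewrite -[y]opprK; apply: (LB).
    exact: (zmod_closed_mulrz L0 LB).
  by rewrite -sub0r; apply: LB.
(* Forbidding the pairs [(0, d)] with [d] nonzero keeps every enlarged graph functional. *)
have [||L [[L0 LP] GL Lfun Lmax]] := @maximal_avoiding int W
    (fun p => G p.1 p.2) (fun p => p.1 = 0 /\ p.2 <> 0).
- by apply: sub_set => // x y; apply: GB.
- by move=> -[x d] /= Gxd [x0]; apply; apply: Gfun; rewrite -x0.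
have LB (p q : W) : L p -> L q -> L (p - q).
  by move=> Lp Lq; rewrite addrC -scaleN1r; apply: LP.
have Lz (p : W) n : L p -> L (p *~ n) by apply: zmod_closed_mulrz.
have {}Lfun d : L (0, d) -> d = 0.
  by move=> Ld; apply: contrapT => d0; apply: (Lfun _ Ld).
have Luniq x d e : L (x, d) -> L (x, e) -> d = e.
  move=> Ld Le; apply/subr0_eq/Lfun.
  by have := LB _ _ Ld Le; rewrite (_ : _ - _ = (x - x, d - e)) // subrr.
have mulzE (x : V) (d : QZ) n : ((x, d) : W) *~ n = (x *~ n, d *~ n).
  by rewrite [LHS]surjective_pairing (raddfMz (fst : {additive V * QZ -> V}))
    (raddfMz (snd : {additive V * QZ -> QZ})).
have Ltot x : exists d, L (x, d).
  (* The [n] for which [x *~ n] is in the domain of [L] form a subgroup generated by some [k];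
     dividing the value [ek] at [x *~ k] by [k] gives a value at [x] compatible with [L]. *)
  have [d dP] : exists d, forall n e, L (x *~ n, e) -> e = d *~ n.
    have [||k [ek Lk] kP] := @int_subgroup_generator (fun n => exists e, L (x *~ n, e)).
    - by exists 0.
    - move=> m n [d Ld] [e Le]; exists (d - e); rewrite mulrzBr.
      exact: (LB (_, _) (_, _)).
    have [d dk] : exists d, d *~ k = ek.
      have [k0|/(QZ_divisible ek)//] := eqVneq k 0.
      by exists 0; move: Lk; rewrite k0 mulr0z => /Lfun.
    exists d => n e Le; have [|q nq] := kP n; first by exists e.
    apply: Luniq Le _; rewrite nq !mulrzA dk -mulzE; exact: Lz.
  exists d; apply: (Lmax (fun p => exists l n, L l /\ p = l + (x, d) *~ n)).
  - apply: sub_set; first by exists 0, 0; rewrite mulr0z addr0.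
    move=> p q [l [n [Ll ->]]] [l' [n' [Ll' ->]]].
    exists (l - l'), (n - n'); split; first exact: LB.
    by rewrite mulrzBr opprD addrACA.
  - by move=> p Lp; exists p, 0; rewrite mulr0z addr0.
  - move=> p [[y e] [n [Ll ->]]]; rewrite mulzE /= => -[yx]; apply.
    have {yx} yE : y = x *~ (- n) by rewrite mulrNz; apply/eqP; rewrite -addr_eq0 yx.
    by rewrite yE in Ll; rewrite (dP _ _ Ll) mulrNz addNr.
  - by exists 0, 1; rewrite add0r.
have [chi chiP] := choice Ltot; exists chi.
  move=> x y; apply: (Luniq (x - y)) => //.
  exact: (LB (_, _) (_, _)).
by move=> x d Gxd; apply: (Luniq x) => //; apply: (GL (x, d)).
Qed.

Lemma QZ_injective (V W : zmodType) (f : V -> W) (chi : V -> QZ) :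
  zmod_morphism f -> injective f -> zmod_morphism chi ->
  exists2 psi : W -> QZ, zmod_morphism psi & forall x, psi (f x) = chi x.
Proof.
move=> fB fI chiB.
have [||d|psi psiB psiP] := @character_extension W (fun y d => exists2 x, f x = y & chi x = d).
- by exists 0; apply: zmod_morphism0.
- by move=> _ _ _ _ [x <- <-] [y <- <-]; exists (x - y).
- move=> [x]; rewrite -(zmod_morphism0 fB) => /fI-> <-; exact: zmod_morphism0.
by exists psi => // x; apply: psiP; exists x.
Qed.

(** The annihilator of [x] is generated by some [k] other than 1 and -1, so some nonzero [d] in Q/Z
    is killed by [k]. Sending [x] to [d] is then a character of the subgroup generated by [x], and
    it extends. *)
Lemma QZ_separates (V : zmodType) (x : V) : x <> 0 ->
  exists2 chi : V -> QZ, zmod_morphism chi & chi x <> 0.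
Proof.
move=> x0.
have [||k k0 kP] := @int_subgroup_generator (fun n => x *~ n = 0).
- by rewrite mulr0z.
- by move=> m n xm xn; rewrite mulrzBr xm xn subr0.
have [|d d0 dk] := @QZ_torsion k.
  apply/eqP => k1; apply: x0; move: k0.
  case: k k1 {kP} => [[|[|//]]|[|//]] //= _; rewrite ?NegzE ?mulrNz mulr1z //.
  by move/eqP; rewrite oppr_eq0 => /eqP.
have [||e|chi chiB chiP] := @character_extension V (fun y e => exists2 n, y = x *~ n & e = d *~ n).
- by exists 0; rewrite mulr0z.
- by move=> _ _ _ _ [m -> ->] [n -> ->]; exists (m - n); rewrite mulrzBr.
- by move=> [n /esym/kP[q ->] ->]; rewrite mulrzA dk mul0rz.
exists chi => //; rewrite (chiP x d) //.
by exists 1.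
Qed.

(** * Projective resolutions and Tor *)

Section FreeModule.
Variables (S : pzRingType) (T : eqType).

(** Finitely supported functions model the free module on [T]; the codomain [S^o] gives functions
    their pointwise module structure. *)
Definition finsupp : {pred T -> S^o} :=
  [pred f : T -> S^o | `[< exists s : seq T, forall x, x \notin s -> f x = 0 >]].

Lemma finsupp_closed : submod_closed finsupp.
Proof.
split=> [|a f g /asboolP[s sf] /asboolP[t tg]]; apply/asboolP; first by exists [::].
exists (s ++ t) => x; rewrite mem_cat negb_or => /andP[xs xt].
by rewrite -[LHS]/(a *: f x + g x) sf // tg // scaler0 addr0.
Qed.

Definition freemod : lmodType S := submodule finsupp_closed.

Definition coord (f : freemod) : T -> S := subincl f.

Lemma coordP a (f g : freemod) x : coord (a *: f + g) x = a * coord f x + coord g x.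
Proof. by []. Qed.

Lemma coord_inj (f g : freemod) : coord f =1 coord g -> f = g.
Proof. by move=> /funext fg; apply: subincl_inj. Qed.

Lemma coord_supp (f : freemod) : exists s : seq T,
  uniq s /\ forall x, x \notin s -> coord f x = 0.
Proof.
have /asboolP[s sf] := subinclP f; exists (undup s).
by rewrite undup_uniq; split=> // x; rewrite mem_undup; apply: sf.
Qed.

Definition freesupp (f : freemod) : seq T := sval (cid (coord_supp f)).

Lemma freesupp_uniq f : uniq (freesupp f).
Proof. by rewrite /freesupp; case: cid => s []. Qed.

Lemma freesuppP f x : x \notin freesupp f -> coord f x = 0.
Proof. by rewrite /freesupp; case: cid => s [us sf] /=; apply: sf. Qed.

Lemma freevec_subproof x : (fun y => (x == y)%:R : S^o) \in finsupp.
Proof.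
by apply/asboolP; exists [:: x] => y; rewrite inE eq_sym => /negPf->.
Qed.

Definition freevec x : freemod :=
  exist (fun f => f \in submod_pred finsupp_closed) _ (freevec_subproof x).

Lemma coord_freevec x y : coord (freevec x) y = (x == y)%:R.
Proof. by []. Qed.

Section Eval.
Variables (A : lmodType S) (v : T -> A).

Definition freeeval (f : freemod) : A :=
  \sum_(x <- freesupp f) coord f x *: v x.

Lemma freeevalE f (s : seq T) : uniq s -> (forall x, x \notin s -> coord f x = 0) ->
  freeeval f = \sum_(x <- s) coord f x *: v x.
Proof.
have nz r : \sum_(x <- r) coord f x *: v x =
    \sum_(x <- [seq x <- r | coord f x != 0]) coord f x *: v x.
  rewrite big_filter [LHS](bigID (fun x => coord f x != 0)) /=.
  by rewrite [X in _ + X]big1 ?addr0 // => x /negPn/eqP->; rewrite scale0r.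
move=> us sf; rewrite /freeeval nz [RHS]nz; apply: perm_big.
apply: uniq_perm; rewrite ?filter_uniq ?freesupp_uniq // => x.
rewrite !mem_filter; case: eqP => //= cx.
by case: (boolP (_ \in s)) => [xs|/sf//]; apply/negPn/negP => /freesuppP.
Qed.

Lemma freeeval_linear : linear freeeval.
Proof.
move=> a f g; pose s := undup (freesupp f ++ freesupp g ++ freesupp (a *: f + g)).
have h0 h : {subset freesupp h <= s} -> forall x, x \notin s -> coord h x = 0.
  by move=> hs x xs; apply: freesuppP; apply: contra xs; apply: hs.
rewrite !(@freeevalE _ s) ?undup_uniq //.
- rewrite scaler_sumr -big_split; apply: eq_bigr => x _.
  by rewrite coordP scalerDl scalerA.
- by apply: h0 => x xg; rewrite mem_undup !mem_cat xg !orbT.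
- by apply: h0 => x xf; rewrite mem_undup !mem_cat xf.
- by apply: h0 => x xh; rewrite mem_undup !mem_cat xh !orbT.
Qed.

HB.instance Definition _ :=
  GRing.isLinear.Build S freemod A *:%R freeeval freeeval_linear.

Lemma freeeval_vec x : freeeval (freevec x) = v x.
Proof.
rewrite (@freeevalE _ [:: x]) // => [|y].
  by rewrite big_seq1 coord_freevec eqxx scale1r.
by rewrite inE eq_sym coord_freevec => /negPf->.
Qed.

End Eval.

Lemma freemod_sum (f : freemod) :
  f = \sum_(x <- freesupp f) coord f x *: freevec x.
Proof.
apply: coord_inj => y.
pose ev (g : freemod) : S^o := coord g y.
have evP : linear ev by [].
pose evL : {linear freemod -> S^o} := HB.pack ev (GRing.isLinear.Build _ _ _ _ ev evP).
rewrite -[RHS]/(evL _) linear_sum.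
under eq_bigr => x _ do rewrite linearZ /= /ev coord_freevec.
have [yf|yf] := boolP (y \in freesupp f).
  rewrite (bigD1_seq y) ?freesupp_uniq //= eqxx big1.
    by rewrite addr0 -[RHS]/(_ * _) mulr1.
  by move=> x /negPf->; rewrite scaler0.
rewrite freesuppP // big_seq big1 // => x xf.
by case: eqP => [xy|]; rewrite ?scaler0 //; move: yf; rewrite -xy xf.
Qed.

Lemma freemod_projective : projective_module freemod.
Proof.
move=> A B p f /choice[s sE].
exists (freeeval (fun x => s (f (freevec x)))) => g.
rewrite /freeeval linear_sum [in RHS](freemod_sum g) [RHS]linear_sum.
by apply: eq_bigr => x _; rewrite !linearZ sE.
Qed.

End FreeModule.

Lemma projective_cover (S : pzRingType) (M : lmodType S) :
  exists (P : lmodType S) (p : {linear P -> M}), projective_module P /\ surjective p.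
Proof.
exists (freemod S M), (freeeval id); split; first exact: freemod_projective.
by move=> x; exists (freevec S x); apply: freeeval_vec.
Qed.

Lemma row_projective (S : pzRingType) n : projective_module 'rV[S]_n.
Proof.
move=> A B p f /choice[s sE].
have [|g gE] := @linear_exists S 'rV[S]_n A
    (fun u => \sum_i u 0 i *: s (f (delta_mx 0 i))).
  move=> a u v; rewrite scaler_sumr -big_split; apply: eq_bigr => i _.
  by rewrite !mxE scalerDl scalerA.
exists g => u; rewrite gE linear_sum [in RHS](row_sum_delta u) linear_sum.
by apply: eq_bigr => i _; rewrite !linearZ sE.
Qed.

Section Resolution.
Variable S : pzRingType.

Lemma kernel_cover (A B : lmodType S) (d : {linear A -> B}) :
  exists (P : lmodType S) (e : {linear P -> A}), projective_module P /\ exact_at e d.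
Proof.
have [P [p [Pp ps]]] := projective_cover (submodule (kernel_closed d)).
exists P, (kerincl d \o p : {linear P -> A}); split=> // y; split.
  by move=> /kerincl_exact[x <-]; have [z <-] := ps x; exists z.
by move=> [x <-]; apply/kerincl_exact; exists (p x).
Qed.

(** Bundling a map with its source and target lets [iter] build a resolution, each arrow covering
    the kernel of the preceding one. *)
Record arrow := Arrow {
  arrow_src : lmodType S;
  arrow_tgt : lmodType S;
  arrow_map : {linear arrow_src -> arrow_tgt} }.

Definition next_arrow (s : arrow) : arrow :=
  Arrow (sval (cid (svalP (cid (kernel_cover (arrow_map s)))))).

Lemma next_arrow_projective s : projective_module (arrow_src (next_arrow s)).
Proof. by rewrite /=; case: cid => P [e []]. Qed.

Lemma next_arrow_exact s : exact_at (arrow_map (next_arrow s)) (arrow_map s).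
Proof. exact: (svalP (cid (svalP (cid (kernel_cover (arrow_map s)))))).2. Qed.

End Resolution.

Section Tor.
Variable R : pzRingType.
Implicit Types (H K P : lmodType R^c) (M N : lmodType R).

Lemma tensor_mapB H K M N (f : {linear H -> K}) (g : {linear M -> N}) :
  {morph tensor_map f g : x y / x - y}.
Proof. exact: raddfB. Qed.

Lemma tensor_map_comp H H' H'' M M' M'' (f : {linear H -> H'})
    (f' : {linear H' -> H''}) (g : {linear M -> M'}) (g' : {linear M' -> M''})
    (f'' : {linear H -> H''}) (g'' : {linear M -> M''}) :
  (forall x, f'' x = f' (f x)) -> (forall x, g'' x = g' (g x)) ->
  forall x, tensor_map f'' g'' x = tensor_map f' g' (tensor_map f g x).
Proof.
move=> fE gE; apply: tensor_ind => [h m|x y xE yE].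
  by rewrite !tensor_mapE fE gE.
by rewrite !tensor_mapB xE yE.
Qed.

Lemma tensor_map_surj H K M (f : {linear H -> K}) :
  surjective f -> surjective (tensor_map f (@idfun M)).
Proof.
move=> fs; apply: tensor_ind => [k m|x y [u <-] [v <-]].
  by have [h <-] := fs k; exists (tens h m); rewrite tensor_mapE.
by exists (u - v); rewrite tensor_mapB.
Qed.

(** Vanishing of Tor is assumed for every projective resolution, so it applies to the one that
    starts with the given [g] and continues by iterated covers of kernels. *)
Lemma Tor1_eq0_exact H P M (g : {linear P -> H}) :
  projective_module P -> surjective g -> Tor1_eq0 H M ->
  exists (P1 P2 : lmodType R^c) (d0 : {linear P1 -> P}) (d1 : {linear P2 -> P1}),
    [/\ exact_at d0 g, exact_at d1 d0 &
        exact_at (tensor_map d1 (@idfun M)) (tensor_map d0 (@idfun M))].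
Proof.
move=> Pp gs TorHM; pose st n := iter n (@next_arrow R^c) (Arrow g).
have stp n : projective_module (arrow_src (st n)).
  by case: n => [|n] //; exact: next_arrow_projective.
pose r := @ProjectiveResolution R^c H (fun n => arrow_src (st n))
  (fun n => arrow_map (st n.+1)) g stp gs
  (@next_arrow_exact _ (st 0%N)) (fun n => @next_arrow_exact _ (st n.+1)).
exists (res_obj r 1), (res_obj r 2), (res_d r 0), (res_d r 1).
by split; [exact: (@res_exact0 _ _ r) | exact: (@res_exact _ _ r) | exact: TorHM].
Qed.

(** [d0] factors through a surjection [c] onto [K]. An element of the kernel lifts along [c] to a
    cycle of the tensored resolution, hence to a boundary, and [c] composed with [d1] is zero. *)
Lemma Tor1_eq0_inj H K P M (g : {linear P -> H}) (i : {linear K -> P}) :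
  projective_module P -> surjective g -> injective i -> exact_at i g ->
  Tor1_eq0 H M -> injective (tensor_map i (@idfun M)).
Proof.
move=> Pp gs iI ig /(Tor1_eq0_exact Pp gs)[P1 [P2 [d0 [d1 [ex0 ex1 exT]]]]].
have [|c cE] := factor_inj (f := d0) iI.
  by move=> x; apply/ig/ex0; exists x.
have cs : surjective c.
  by move=> k; have /ex0[x xE] : g (i k) = 0; [apply/ig; exists k | exists x; apply: iI; rewrite cE].
apply: inj_eq0 => [|x]; first exact: tensor_mapB.
have [y <-] := tensor_map_surj cs x.
rewrite -(tensor_map_comp (f'' := d0) (g'' := @idfun M)) // => /exT[z <-].
have cd x1 : c (d1 x1) = (\0 : {linear P2 -> K}) x1.
  by apply: iI; rewrite cE /= linear0; apply/ex1; exists x1.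
rewrite -(tensor_map_comp (f'' := (c \o d1 : {linear P2 -> K})) (g'' := @idfun M)) //.
elim/tensor_ind: z => [h m|u v uE vE]; last by rewrite tensor_mapB uE vE subrr.
rewrite tensor_mapE /= cd /=.
by apply: (addrI (tens 0 m)); rewrite -tensDl !addr0.
Qed.

(** A section of the augmentation yields a contracting homotopy [h0], [h1] in low degrees, and its
    identity survives tensoring with [M]. *)
Lemma projective_Tor1_eq0 H M : projective_module H -> Tor1_eq0 H M.
Proof.
move=> Hp r; have [s sE] := projective_section Hp (@res_aug_surj _ _ r).
have [|h0 h0E] := projective_lift_exact (f := (idfun \- (s \o res_aug r) : {linear res_obj r 0 -> res_obj r 0}))
    (@res_projective _ _ r 0) (@res_exact0 _ _ r).
  by move=> x /=; rewrite linearB sE subrr.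
have d0d1 x : res_d r 0 (res_d r 1 x) = 0 by apply/(@res_exact _ _ r); exists x.
have [|h1 h1E] := projective_lift_exact (f := (idfun \- (h0 \o res_d r 0) : {linear res_obj r 1 -> res_obj r 1}))
    (@res_projective _ _ r 1) (@res_exact _ _ r 0).
  move=> x /=; rewrite linearB h0E /=.
  have -> : res_aug r (res_d r 0 x) = 0 by apply/(@res_exact0 _ _ r); exists x.
  by rewrite linear0 subr0 subrr.
have hmt x : x = tensor_map (res_d r 1) (@idfun M) (tensor_map h1 (@idfun M) x)
               + tensor_map h0 (@idfun M) (tensor_map (res_d r 0) (@idfun M) x).
  elim/tensor_ind: x => [h m|x y xE yE].
    by rewrite !tensor_mapE -tensDl h1E /= subrK.
  by rewrite !tensor_mapB addrACA -opprD -xE -yE.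
move=> x; split=> [x0|[y <-]].
  by exists (tensor_map h1 (@idfun M) x); rewrite [RHS]hmt x0 raddf0 addr0.
elim/tensor_ind: y => [h m|x1 x2 E1 E2]; last by rewrite !tensor_mapB E1 E2 subrr.
rewrite !tensor_mapE d0d1.
by apply: (addrI (tens 0 m)); rewrite -tensDl !addr0.
Qed.

End Tor.

(** * Testing tensor products on quotients of R^m *)

Lemma zmod_quotient (V : zmodType) (L : V -> Prop) :
  L 0 -> (forall x y, L x -> L y -> L (x - y)) ->
  exists (Q : zmodType) (p : V -> Q), zmod_morphism p /\ forall x, p x = 0 <-> L x.
Proof.
move=> L0 LB; have LP : @submod_set int (zmodule V) L.
  split=> // a x y Lx Ly; rewrite -[y]opprK; apply: (LB).
    exact: (zmod_closed_mulrz L0 LB).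
  by rewrite -sub0r; apply: LB.
exists (quomod (submod_setP LP)), (quoproj (submod_setP LP)); split=> x.
  exact: (raddfB (quoproj (submod_setP LP)) x).
by split=> [/quoproj_eq0/asboolP//|Lx]; apply/quoproj_eq0/asboolP.
Qed.

Section RowTensor.
Variable R : pzRingType.
Implicit Types (H K P : lmodType R^c) (M N : lmodType R).

Lemma tens0l H M m : tens (0 : H) (m : M) = 0.
Proof. by apply: (addrI (tens 0 m)); rewrite -tensDl !addr0. Qed.

Lemma tens0r H M h : tens (h : H) (0 : M) = 0.
Proof. by apply: (addrI (tens h 0)); rewrite -tensDr !addr0. Qed.

Lemma tens_suml H M I (r : seq I) (F : I -> H) (m : M) :
  tens (\sum_(i <- r) F i) m = \sum_(i <- r) tens (F i) m.
Proof.
by apply: (big_morph (fun h => tens h m)) => [h h'|]; rewrite ?tensDl ?tens0l.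
Qed.

Lemma tens_sumr H M I (r : seq I) (F : I -> M) (h : H) :
  tens h (\sum_(i <- r) F i) = \sum_(i <- r) tens h (F i).
Proof.
by apply: (big_morph (fun m => tens h m)) => [m m'|]; rewrite ?tensDr ?tens0r.
Qed.

Lemma tensor_map_sum H K M N (f : {linear H -> K}) (g : {linear M -> N}) I
    (r : seq I) (F : I -> tensor H M) :
  tensor_map f g (\sum_(i <- r) F i) = \sum_(i <- r) tensor_map f g (F i).
Proof. exact/zmod_morphism_sum/tensor_mapB. Qed.

Lemma coord_balanced H m (j : 'I_m) :
  balanced (fun (h : H) (v : 'rV[R]_m) => (v 0 j : R^c) *: h).
Proof.
by split=> [h h' v|h v v'|r h v]; rewrite ?mxE ?scalerDr ?scalerDl ?scalerA.
Qed.

(** Component [j] of the isomorphism of H (x) R^m with H^m; the sum in [row_tensorE] is its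
    inverse. *)
Definition row_coord H m (j : 'I_m) : tensor H 'rV[R]_m -> H :=
  tensor_lift (fun (h : H) (v : 'rV[R]_m) => (v 0 j : R^c) *: h).

Lemma row_coord_tens H m (j : 'I_m) (h : H) (v : 'rV[R]_m) :
  row_coord j (tens h v) = (v 0 j : R^c) *: h.
Proof. exact/tensor_lift_tens/coord_balanced. Qed.

Lemma row_coordB H m (j : 'I_m) : {morph @row_coord H m j : x y / x - y}.
Proof. exact/tensor_lift_zmod_morphism/coord_balanced. Qed.

Lemma row_coord_map H K m (j : 'I_m) (f : {linear H -> K}) x :
  row_coord j (tensor_map f (@idfun 'rV[R]_m) x) = f (row_coord j x).
Proof.
elim/tensor_ind: x => [h v|x y xE yE].
  by rewrite tensor_mapE !row_coord_tens linearZ.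
by rewrite tensor_mapB !row_coordB linearB xE yE.
Qed.

Lemma row_tensorE H m (x : tensor H 'rV[R]_m) :
  x = \sum_j tens (row_coord j x) (delta_mx 0 j).
Proof.
elim/tensor_ind: x => [h v|x y xE yE].
  rewrite {1}(row_sum_delta v) tens_sumr; apply: eq_bigr => j _.
  by rewrite row_coord_tens -tensZ.
rewrite {1}xE {1}yE -sumrB; apply: eq_bigr => j _.
by rewrite row_coordB; apply/eqP; rewrite subr_eq -tensDl subrK.
Qed.

(** In coordinates, a resolution tensored with R^m is m copies of the resolution itself, which is
    exact. *)
Lemma row_Tor1_eq0 H m : Tor1_eq0 H 'rV[R]_m.
Proof.
move=> r x; split=> [x0|[y <-]].
  have /choice[q qE] j : exists q, res_d r 1 q = row_coord j x.
    apply/(@res_exact _ _ r); rewrite -row_coord_map x0.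
    exact/zmod_morphism0/row_coordB.
  exists (\sum_j tens (q j) (delta_mx 0 j)).
  by rewrite tensor_map_sum [RHS]row_tensorE; apply: eq_bigr => j _;
    rewrite tensor_mapE qE.
elim/tensor_ind: y => [h m'|x1 x2 E1 E2]; last by rewrite !tensor_mapB E1 E2 subrr.
rewrite !tensor_mapE (_ : res_d r 0 _ = 0) ?tens0l //.
by apply/(@res_exact _ _ r); exists h.
Qed.

(** Scalars move across the tensor sign, so the image is governed by the rows of the coordinate
    matrix of the [k j]: it vanishes once [q] kills these rows. *)
Lemma tensor_map_row_sum K N m n (i : {linear K -> 'rV[R^c]_n}) (k : 'I_m -> K)
    (q : {linear 'rV[R]_m -> N}) :
  tensor_map i (@idfun N) (\sum_j tens (k j) (q (delta_mx 0 j))) =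
  \sum_l tens (delta_mx 0 l) (q (\row_j (i (k j) 0 l : R))).
Proof.
have rowE l : \row_j (i (k j) 0 l : R) = \sum_j (i (k j) 0 l : R) *: delta_mx 0 j.
  by rewrite [LHS]row_sum_delta; apply: eq_bigr => j _; rewrite mxE.
rewrite tensor_map_sum.
have -> : \sum_j tensor_map i (@idfun N) (tens (k j) (q (delta_mx 0 j))) =
    \sum_j \sum_l tens (delta_mx 0 l) (q ((i (k j) 0 l : R) *: delta_mx 0 j)).
  apply: eq_bigr => j _; rewrite tensor_mapE {1}[i (k j)]row_sum_delta tens_suml.
  by apply: eq_bigr => l _; rewrite tensZ linearZ.
rewrite exchange_big; apply: eq_bigr => l _.
by rewrite rowE linear_sum tens_sumr.
Qed.

(** The map v - i (f v) kills the image of [i], hence factors through [g], and the factor is a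
    section of [g]. *)
Lemma projective_of_retraction (S : pzRingType) (H K P : lmodType S)
    (g : {linear P -> H}) (i : {linear K -> P}) (f : {linear P -> K}) :
  projective_module P -> surjective g -> exact_at i g -> cancel i f ->
  projective_module H.
Proof.
move=> Pp gs ig fi.
have [|s sE] := factor_surj (f := (idfun \- (i \o f) : {linear P -> P})) gs.
  by move=> v /ig[h <-] /=; rewrite fi subrr.
apply: (@projective_retract _ _ _ s g) Pp.
move=> h; have [v <-] := gs h; rewrite sE /= linearB /= -[RHS]subr0; congr (_ - _).
by apply/ig; exists (f v).
Qed.

(* Villamayor's argument: if the generators k_j of K have coordinates a_lj in
   R^n, test the hypothesis on M = R^m / (rows of a).  The element
   sum_j k_j (x) [e_j] dies in R^n (x) M, and its vanishing in K (x) M says that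
   k_j = sum_l y_l a_lj for some y_l in K; then e_l |-> y_l retracts R^n onto K. *)
Lemma projective_of_tensor_inj H K n (g : {linear 'rV[R^c]_n -> H})
    (i : {linear K -> 'rV[R^c]_n}) :
  surjective g -> exact_at i g -> finitely_generated K ->
  (forall m (N : lmodType R) (q : {linear 'rV[R]_m -> N}), surjective q ->
     injective (tensor_map i (@idfun N))) ->
  projective_module H.
Proof.
move=> gs ig [m [k kP]] tinj.
pose a : 'M[R]_(n, m) := \matrix_(l, j) (i (k j) 0 l : R).
have [rowa rowaE] : exists f : {linear 'rV[R]_n -> 'rV[R]_m},
    forall u, f u = \sum_l u 0 l *: row l a.
  have [c u v|f fE] := @linear_exists R 'rV[R]_n 'rV[R]_m (fun u => \sum_l u 0 l *: row l a).
    rewrite scaler_sumr -big_split; apply: eq_bigr => l _.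
    by rewrite !mxE scalerDl scalerA.
  by exists f.
pose N := quomod (range_closed rowa); pose q : {linear 'rV[R]_m -> N} := quoproj (range_closed rowa).
have q0 v : q v = 0 <-> exists u, rowa u = v.
  by split=> [/quoproj_eq0/asboolP//|uv]; apply/quoproj_eq0/asboolP.
pose x : tensor K N := \sum_j tens (k j) (q (delta_mx 0 j)).
have x0 : x = 0.
  apply: (tinj m N q (@quoproj_surj _ _ _ _)).
  rewrite (zmod_morphism0 (@tensor_mapB _ _ _ _ _ _ _)) tensor_map_row_sum.
  rewrite big1 // => l _; rewrite (_ : q _ = 0) ?tens0r //; apply/q0.
  exists (delta_mx 0 l); rewrite rowaE (bigD1 l) //= big1 => [|l' l'l].
    by rewrite mxE !eqxx scale1r addr0; apply/rowP => j; rewrite !mxE.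
  by rewrite mxE eqxx (negPf l'l) scale0r.
(* To exploit [x = 0], K (x) N is mapped to the quotient of K^m by [L], the tuples with entries
   sum_l y_l a_lj. The class of [b0 h v], the tuple of all h v_j, depends on [v] only through [q v],
   and [x] goes to the class of [k]. *)
pose b0 (h : K) (v : 'rV[R]_m) : 'I_m -> K := fun j => (v 0 j : R^c) *: h.
pose L (z : 'I_m -> K) := exists y : 'I_n -> K, forall j, z j = \sum_l (a l j : R^c) *: y l.
have [||Q [p [pB p0]]] := @zmod_quotient ('I_m -> K)%type L.
- by exists (fun=> 0) => j; rewrite big1 // => l _; rewrite scaler0.
- move=> z z' [y yE] [y' y'E]; exists (fun l => y l - y' l) => j.
  rewrite -[LHS]/(z j - z' j) yE y'E -sumrB; apply: eq_bigr => l _.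
  by rewrite scalerBr.
have pD := zmod_morphismD pB.
have b0B h v v' : b0 h (v - v') = b0 h v - b0 h v'.
  by apply/funext => j; rewrite /b0 !mxE scalerBl.
have p_eq h v v' : q v = q v' -> p (b0 h v) = p (b0 h v').
  move=> qv; apply/subr0_eq; rewrite -pB -b0B; apply/p0.
  have /q0[u <-] : q (v - v') = 0 by rewrite linearB qv subrr.
  exists (fun l => (u 0 l : R^c) *: h) => j; rewrite /b0 rowaE summxE scaler_suml.
  by apply: eq_bigr => l _; rewrite !mxE scalerA.
have /choice[rep repE] : forall z, exists v, q v = z by exact: quoproj_surj.
pose b h (z : N) := p (b0 h (rep z)).
have bq h v : b h (q v) = p (b0 h v) by apply/p_eq/repE.
have b_bal : balanced b.
  split=> [h h' z|h z z'|r h z]; rewrite /b.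
  - by rewrite -pD; congr p; apply/funext => j; rewrite /b0 scalerDr.
  - rewrite -pD (p_eq _ _ (rep z + rep z')); last by rewrite linearD !repE.
    by congr p; apply/funext => j; rewrite /b0 mxE scalerDl.
  - rewrite (p_eq _ (rep (r *: z)) (r *: rep z)); last by rewrite linearZ /= !repE.
    by congr p; apply/funext => j; rewrite /b0 mxE scalerA.
have /p0[y yE] : p k = 0.
  have := zmod_morphism0 (tensor_lift_zmod_morphism b_bal); rewrite -x0.
  rewrite (zmod_morphism_sum _ _ (tensor_lift_zmod_morphism b_bal)).
  under eq_bigr => j _ do rewrite (tensor_lift_tens b_bal) bq.
  rewrite -(zmod_morphism_sum _ _ pB) => <-; congr p; apply/funext => j.
  rewrite fct_sumE (bigD1 j) //= big1 => [|j' j'j].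
    by rewrite /b0 mxE !eqxx scale1r addr0.
  by rewrite /b0 mxE eqxx eq_sym (negPf j'j) scale0r.
have [c u v|f fE] := @linear_exists R^c 'rV[R^c]_n K (fun u => \sum_l u 0 l *: y l).
  rewrite scaler_sumr -big_split; apply: eq_bigr => l _.
  by rewrite !mxE scalerDl scalerA.
have fi : cancel i f.
  move=> h; have [d ->] := kP h; rewrite !linear_sum; apply: eq_bigr => j _.
  rewrite !linearZ fE; congr (_ *: _); rewrite [RHS]yE; apply: eq_bigr => l _.
  by rewrite mxE.
exact: (projective_of_retraction (@row_projective _ _) gs ig fi).
Qed.

End RowTensor.

(** * Character modules *)

(** The dual of a left module is a right module and conversely; reversing products through a ring
    anti-homomorphism lets one construction serve both directions. *)
Record antimorphism (S' S : pzRingType) := Antimorphism {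
  amap :> S' -> S;
  amapD : {morph amap : a b / a + b};
  amap1 : amap 1 = 1;
  amapM : forall a b, amap (a * b) = amap b * amap a }.

Section CharacterModule.
Variables (S' S : pzRingType) (sigma : antimorphism S' S) (M : lmodType S).

Definition is_character : {pred M -> zmodule QZ} :=
  [pred chi : M -> QZ | `[< zmod_morphism chi >]].

Lemma is_character_closed : submod_closed is_character.
Proof.
split=> [|a f g /asboolP fB /asboolP gB]; apply/asboolP => x y.
  by rewrite -[RHS]/(0 - 0) subrr.
rewrite -[LHS]/(a *: f (x - y) + g (x - y)) fB gB.
by rewrite -[RHS]/((a *: f x + g x) - (a *: f y + g y)) scalerBr opprD addrACA.
Qed.

Definition charmod : Type := let _ := sigma in submodule is_character_closed.
HB.instance Definition _ := GRing.Zmodule.on charmod.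

Definition char (c : charmod) : M -> QZ := subincl (c : submodule is_character_closed).

Lemma charB c : zmod_morphism (char c).
Proof. exact/asboolP/(subinclP (c : submodule is_character_closed)). Qed.

Lemma char_inj c c' : char c =1 char c' -> c = c'.
Proof. by move=> /funext cc'; apply: subincl_inj. Qed.

Lemma char_add c c' x : char (c + c') x = char c x + char c' x.
Proof. by []. Qed.

Lemma char_exists (chi : M -> QZ) : zmod_morphism chi -> exists c, char c = chi.
Proof.
move=> chiB; have [|c cE] := @subincl_surj _ _ _ is_character_closed chi.
  exact/asboolP.
by exists c.
Qed.

Lemma charmod_scale_subproof a c : exists c', char c' = fun x => char c (sigma a *: x).
Proof. by apply: char_exists => x y; rewrite scalerBr charB. Qed.

Definition charmod_scale a c : charmod := sval (cid (charmod_scale_subproof a c)).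

Lemma char_scale a c x : char (charmod_scale a c) x = char c (sigma a *: x).
Proof. by rewrite /charmod_scale; case: cid => c' /= ->. Qed.

Fact charmod_scaleA a b c :
  charmod_scale a (charmod_scale b c) = charmod_scale (a * b) c.
Proof. by apply: char_inj => x; rewrite !char_scale amapM scalerA. Qed.
Fact charmod_scale1 : left_id 1 charmod_scale.
Proof. by move=> c; apply: char_inj => x; rewrite char_scale amap1 scale1r. Qed.
Fact charmod_scaleDr : right_distributive charmod_scale +%R.
Proof. by move=> a c c'; apply: char_inj => x; rewrite !(char_add, char_scale). Qed.
Fact charmod_scaleDl c : {morph charmod_scale^~ c : a b / a + b}.
Proof.
move=> a b; apply: char_inj => x; rewrite char_add !char_scale amapD scalerDl.
exact/zmod_morphismD/charB.
Qed.

HB.instance Definition _ := GRing.Zmodule_isLmodule.Build S' charmod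
  charmod_scaleA charmod_scale1 charmod_scaleDr charmod_scaleDl.

Lemma charZ a c x : char (a *: c) x = char c (sigma a *: x).
Proof. exact: char_scale. Qed.

Lemma charP a c c' x : char (a *: c + c') x = char c (sigma a *: x) + char c' x.
Proof. by rewrite char_add charZ. Qed.

Lemma char_subr c c' x : char (c - c') x = char c x - char c' x.
Proof. by []. Qed.

End CharacterModule.

Lemma charmod_map (S' S : pzRingType) (sigma : antimorphism S' S)
    (M N : lmodType S) (f : {linear M -> N}) :
  exists g : {linear charmod sigma N -> charmod sigma M},
    forall c x, char (g c) x = char c (f x).
Proof.
have /choice[g gE] c : exists c' : charmod sigma M, char c' = char (c : charmod sigma N) \o f.
  by apply: char_exists => x y /=; rewrite linearB charB.
have [a c c'|h hE] := @linear_exists _ _ _ g.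
  by apply: char_inj => x; rewrite charP !gE /= charP -linearZ.
by exists h => c x; rewrite hE gE.
Qed.

Section CharacterDuality.
Variable R : pzRingType.
Implicit Types (H K F P X : lmodType R^c) (M N A B : lmodType R).

Definition to_converse : antimorphism R R^c :=
  @Antimorphism R R^c (fun a => a) (fun _ _ => erefl) erefl (fun _ _ => erefl).

Definition of_converse : antimorphism R^c R :=
  @Antimorphism R^c R (fun a => a) (fun _ _ => erefl) erefl (fun _ _ => erefl).

Local Notation rdual H := (charmod to_converse H).
Local Notation ldual M := (charmod of_converse M).

(** Flatness in terms of Q/Z-valued balanced maps, without tensor products; [flat_char_flat]
    identifies the two notions. *)
Definition char_flat H := forall A B (j : {linear A -> B}) (b : H -> A -> QZ),
  injective j -> balanced b ->
  exists2 b' : H -> B -> QZ, balanced b' & forall h x, b' h (j x) = b h x.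

Lemma tens_balanced_comp H M (A : zmodType) (l : tensor H M -> A) :
  zmod_morphism l -> balanced (fun h m => l (tens h m)).
Proof.
move=> /zmod_morphismD lD; split=> *; rewrite -?lD ?tensDl ?tensDr //.
by rewrite tensZ.
Qed.

(** Balanced maps to Q/Z are the characters of the tensor product. They extend along an injection
    because Q/Z is injective; conversely, if all of them extend, every character kills the kernel,
    which is then zero since characters separate points. *)
Lemma tensor_inj_extension H K M N (u : {linear H -> K}) (v : {linear M -> N}) :
  injective (tensor_map u v) <->
  forall b : H -> M -> QZ, balanced b ->
    exists2 b' : K -> N -> QZ, balanced b' & forall h m, b' (u h) (v m) = b h m.
Proof.
split=> [uvI b bb|ext].
  have [chi chiB chiE] := QZ_injective (@tensor_mapB _ _ _ _ _ u v) uvI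
    (tensor_lift_zmod_morphism bb).
  exists (fun k n => chi (tens k n)); first exact: tens_balanced_comp.
  by move=> h m; rewrite -tensor_mapE chiE tensor_lift_tens.
apply: inj_eq0 => [|x x0]; first exact: tensor_mapB.
apply: contrapT => /QZ_separates[chi chiB]; apply.
have [b' bb' b'E] := ext _ (tens_balanced_comp chiB).
have lB := tensor_lift_zmod_morphism bb'.
suff -> : chi x = tensor_lift b' (tensor_map u v x) by rewrite x0 zmod_morphism0.
elim/tensor_ind: {x0} x => [h m|x y xE yE].
  by rewrite tensor_mapE (tensor_lift_tens bb') b'E.
by rewrite tensor_mapB chiB lB xE yE.
Qed.

Lemma flat_char_flat H : flat H <-> char_flat H.
Proof.
split=> [Hf A B j b jI bb|Hf A B j jI]; last first.
  by apply/tensor_inj_extension => b bb; apply: Hf.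
by have /tensor_inj_extension/(_ b bb) := Hf _ _ j jI.
Qed.

(** A linear map from [A] to the dual of [H] amounts to a balanced map on [H] and [A], so extending
    the one is extending the other. *)
Lemma char_flat_injective H : char_flat H -> injective_module (rdual H).
Proof.
move=> Hf A B j f jI.
have [|b' [b'l b'r b'z] b'E] := Hf A B j (fun h x => char (f x) h) jI.
  split=> [h h' x|h x y|r h x].
  - exact/zmod_morphismD/charB.
  - by rewrite linearD.
  - by rewrite linearZ charZ.
have /choice[g gE] y : exists c : rdual H, char c = b'^~ y.
  by apply/char_exists/additive_zmod_morphism => h h'; rewrite b'l.
have [a y z|k kE] := @linear_exists _ _ _ g.
  by apply: char_inj => h; rewrite charP !gE b'r b'z.
by exists k => x; apply: char_inj => h; rewrite kE gE b'E.
Qed.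

(** A balanced map is a linear map from [H] to the dual of [A]. The dual of [j] is surjective
    because Q/Z is injective, so projectivity lifts this map to the dual of [B]. *)
Lemma projective_char_flat H : projective_module H -> char_flat H.
Proof.
move=> Hp A B j b jI [bl br bz].
have [j' j'E] := charmod_map of_converse j.
have /choice[f fE] h : exists c : ldual A, char c = b h.
  by apply/char_exists/additive_zmod_morphism => x y; rewrite br.
have [a h h'|f' f'E] := @linear_exists _ _ _ f.
  by apply: char_inj => x; rewrite charP !fE bl bz.
have [|g gE] := Hp _ _ j' f'.
  move=> c; have [d dB dE] := QZ_injective (raddfB j) jI (@charB _ _ _ _ c).
  have [e eE] := char_exists of_converse dB.
  by exists e; apply: char_inj => x; rewrite j'E eE dE.
exists (fun h y => char (g h) y); last by move=> h x; rewrite -j'E gE f'E fE.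
split=> [h h' y|h x y|r h y].
- by rewrite linearD.
- exact/zmod_morphismD/charB.
- by rewrite linearZ charZ.
Qed.

(* The dual of p is a split monomorphism, so that characters of K extend
   linearly to X: correct any extension by the part that comes from F. *)
Lemma char_flat_pure K X F (i : {linear K -> X}) (p : {linear X -> F}) :
  injective i -> exact_at i p -> surjective p -> char_flat F ->
  forall A (b : K -> A -> QZ), balanced b ->
    exists2 b' : X -> A -> QZ, balanced b' & forall k x, b' (i k) x = b k x.
Proof.
move=> iI ip ps Ff A b [bl br bz].
have [p' p'E] := charmod_map to_converse p.
(* Flatness of [F] extends the evaluation pairing of [F] with its dual along [p'] to the dual of
   [X]; this [t] encodes a retraction of [p']. *)
have [||t [tl tr tz] tE] := Ff _ _ p' (fun h c => char c h).
- move=> c c' cc'; apply: char_inj => h; have [x <-] := ps h.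
  by rewrite -!p'E cc'.
- split=> [h h' c|h c c'|r h c] //; last by rewrite charZ.
  exact/zmod_morphismD/charB.
have /choice[e eE] x : exists c : rdual X, forall k, char c (i k) = b k x.
  have bxB : zmod_morphism (b^~ x) by apply: additive_zmod_morphism => k k'; rewrite bl.
  have [d dB dE] := QZ_injective (raddfB i) iI bxB.
  by have [c cE] := char_exists to_converse dB; exists c => k; rewrite cE dE.
have t0 (c : rdual X) : (forall k, char c (i k) = 0) ->
    forall x, char c x = t (p x) c.
  move=> c0 x; have cB := @charB _ _ _ _ c.
  have [|||c' c'B c'E] := @character_extension F (fun y d => exists2 x, p x = y & char c x = d).
  - by exists 0; rewrite ?linear0 // (zmod_morphism0 cB).
  - by move=> _ _ _ _ [y <- <-] [z <- <-]; exists (y - z); rewrite ?linearB ?cB.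
  - by move=> d [y /ip[k <-] <-].
  have [c'' c''E] := char_exists to_converse c'B.
  have -> : c = p' c'' by apply: char_inj => y; rewrite p'E c''E; apply/esym/c'E; exists y.
  by rewrite p'E tE.
(* The chosen extension [e x] need not be linear in [x]. Once its part coming from [F] is
   subtracted, the result no longer depends on the choice, by [sP], and is therefore balanced. *)
pose s x y := char (e x) y - t (p y) (e x).
have tB h : zmod_morphism (t h) by apply: additive_zmod_morphism => c c'; rewrite tr.
have sP (c : rdual X) x : (forall k, char c (i k) = b k x) ->
    forall y, s x y = char c y - t (p y) c.
  move=> cE y; have : char (e x - c) y = t (p y) (e x - c).
    by apply: t0 => k; rewrite char_subr eE cE subrr.
  rewrite char_subr tB /s => /eqP; rewrite subr_eq => /eqP->.
  by rewrite -[_ - _ + _]addrA [LHS]addrC addKr addrC.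
have tl0 c : t 0 c = 0 by apply: (addrI (t 0 c)); rewrite -tl !addr0.
exists (fun y x => s x y); last first.
  by move=> k x; rewrite /s eE (_ : p (i k) = 0) ?tl0 ?subr0 //; apply/ip; exists k.
split=> [y y' x|y x x'|r y x].
- by rewrite /s linearD tl (zmod_morphismD (@charB _ _ _ _ _)) opprD addrACA.
- rewrite (sP (e x + e x')) => [|k]; last by rewrite char_add !eE br.
  by rewrite char_add tr opprD addrACA.
- rewrite [RHS](sP (r *: e x)) => [|k]; last by rewrite charZ -linearZ eE bz.
  by rewrite charZ -tz -linearZ.
Qed.

(** A balanced map on [K] and [A] extends to [X] and [A] by purity, then along [j] by flatness of
    [X], and is finally restricted to [K]. *)
Lemma char_flat_kernel K X F (i : {linear K -> X}) (p : {linear X -> F}) :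
  injective i -> exact_at i p -> surjective p -> char_flat F -> char_flat X ->
  char_flat K.
Proof.
move=> iI ip ps Ff Xf A B j b jI bb.
have [b1 bb1 b1E] := char_flat_pure iI ip ps Ff bb.
have [b2 [b2l b2r b2z] b2E] := Xf _ _ _ _ jI bb1.
exists (fun k y => b2 (i k) y); last by move=> k x; rewrite b2E b1E.
by split=> [k k' y|k y y'|r k y]; rewrite ?linearD ?linearZ ?b2l ?b2r ?b2z.
Qed.

Lemma char_flat_prod F P : char_flat F -> char_flat P -> char_flat (F * P)%type.
Proof.
move=> Ff Pf A B j b jI [bl br bz].
have bsum x y m : b (x, y) m = b (x, 0) m + b (0, y) m.
  by rewrite -bl -[(_, _) + _]/(x + 0, 0 + y) addr0 add0r.
have [|b1 [b1l b1r b1z] b1E] := Ff _ _ j (fun x m => b (x, 0) m) jI.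
  split=> [x x' m|x m m'|r x m]; rewrite ?br //.
    by rewrite -bl -[(_, _) + _]/(x + x', 0 + 0) addr0.
  by rewrite -bz -[_ *: (_, _)]/(_ *: x, _ *: 0) scaler0.
have [|b2 [b2l b2r b2z] b2E] := Pf _ _ j (fun y m => b (0, y) m) jI.
  split=> [x x' m|x m m'|r x m]; rewrite ?br //.
    by rewrite -bl -[(_, _) + _]/(0 + 0, x + x') addr0.
  by rewrite -bz -[_ *: (_, _)]/(_ *: 0, _ *: x) scaler0.
exists (fun z y => b1 z.1 y + b2 z.2 y); last by move=> [x y] m; rewrite b1E b2E -bsum.
split=> [z z' y|z y y'|r z y]; rewrite ?b1l ?b2l ?b1r ?b2r ?b1z ?b2z //;
  by rewrite addrACA.
Qed.

Lemma char_flat_tensor_inj K X F M (i : {linear K -> X}) (p : {linear X -> F}) :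
  injective i -> exact_at i p -> surjective p -> char_flat F ->
  injective (tensor_map i (@idfun M)).
Proof.
by move=> iI ip ps Ff; apply/tensor_inj_extension/(char_flat_pure iI ip ps Ff).
Qed.

(* K is also the kernel of F1 (+) P -> F0, where P -> F0 lifts g. *)
Lemma flat_dim_le1_kernel H K P (g : {linear P -> H}) (i : {linear K -> P}) :
  flat_dim_le1 H -> projective_module P -> surjective g -> injective i ->
  exact_at i g -> char_flat K.
Proof.
move=> [F1 [F0 [j [q [/flat_char_flat F1f /flat_char_flat F0f jI jq qs]]]]] Pp gs iI ig.
have [t tE] := Pp _ _ q g qs.
have [|a aE] := factor_inj (f := (\- (t \o i) : {linear K -> F0})) jI.
  by move=> k; apply/jq => /=; rewrite linearN tE; apply/eqP; rewrite oppr_eq0;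
    apply/eqP/ig; exists k.
(* [u] and [v] will form an exact sequence; the sign in [a] makes their composite zero. *)
have [c x y|u uE] := @linear_exists _ K (F1 * P)%type (fun k => (a k, i k)).
  by rewrite !linearP.
have [c x y|v vE] := @linear_exists _ (F1 * P)%type F0 (fun z => j z.1 + t z.2).
  by rewrite !linearP /= scalerDr addrACA.
apply: (@char_flat_kernel _ _ _ u v) => //.
- by move=> k k'; rewrite !uE => -[_ /iI].
- move=> [x y]; rewrite vE /=; split=> [xy0|[k]]; last first.
    by rewrite uE => -[<- <-]; rewrite aE /= addNr.
  have /ig[k kE] : g y = 0.
    rewrite -tE -[t y](addKr (j x)) xy0 addr0 linearN (_ : q (j x) = 0) ?oppr0 //.
    by apply/jq; exists x.
  exists k; rewrite uE kE; congr (_, _); apply: jI; rewrite aE /= kE.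
  by apply/eqP; rewrite eq_sym -addr_eq0 xy0.
- move=> z; have [y yE] := gs (q z).
  have /jq[x xE] : q (z - t y) = 0 by rewrite linearB tE yE subrr.
  by exists (x, y); rewrite vE /= xE subrK.
- exact/char_flat_prod/projective_char_flat.
Qed.

(** With [P] projective and mapping onto the dual of [M], the module [M] maps to its bidual and on
    to the dual of [P]. The composite is injective since characters separate points, and the target
    is injective since [P] is flat. *)
Lemma enough_injectives M : exists (E : lmodType R) (j : {linear M -> E}),
  injective_module E /\ injective j.
Proof.
have [P [p [Pp ps]]] := projective_cover (ldual M).
have /choice[f fE] m : exists c : rdual P, char c = fun x => char (p x) m.
  by apply: char_exists => x y; rewrite linearB char_subr.
have [a m m'|j jE] := @linear_exists _ _ _ f.
  apply: char_inj => x; rewrite charP !fE linearZ charZ.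
  exact/zmod_morphismD/charB.
exists (rdual P), j; split; first exact/char_flat_injective/projective_char_flat.
apply: inj_eq0 => [|m jm]; first exact: raddfB.
apply: contrapT => /QZ_separates[chi chiB]; apply.
have [c <-] := char_exists of_converse chiB; have [x <-] := ps c.
by have := congr1 (fun c => char c x) jm; rewrite jE fE.
Qed.

End CharacterDuality.

(** * Injective envelopes and presentations *)

Section Envelope.
Variable R : pzRingType.

Lemma essential_comp (M N E : lmodType R) (k : {linear M -> N}) (i : {linear N -> E}) :
  injective i -> essential k -> essential i -> essential (i \o k).
Proof.
move=> iI ke ie A clA AM; apply: (ie A clA) => x Ax.
have clA' : submod_closed [pred m | i m \in A].
  by split=> [|a y z]; rewrite !inE ?linear0 ?clA.1 // linearP => yA zA; apply: clA.2.
suff -> : x = 0 by rewrite linear0.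
apply: (ke _ clA' _ x) => // y; rewrite inE => /AM /= ky0.
by apply: iI; rewrite ky0 linear0.
Qed.

(* Inside an injective E0 containing M, let C be maximal with C /\ M = 0 and
   E >= M maximal with E /\ C = 0.  Then M is essential in E by maximality of C,
   and E is a direct summand of E0: E -> E0 extends along E -> E0 / C, and by
   maximality of E the extension still lands in E. *)
Lemma injective_envelope_exists (M : lmodType R) :
  exists (E : lmodType R) (i : {linear M -> E}), injective_envelope i.
Proof.
have [E0 [j [E0i jI]]] := enough_injectives M.
have [||C [sC _ CM Cmax]] := @maximal_avoiding R E0 (fun x => x = 0)
    (fun x => x <> 0 /\ exists m, j m = x).
- by split=> // a x y -> ->; rewrite scaler0 addr0.
- by move=> x x0 [].
have [||D [sD MD DC Dmax]] := @maximal_avoiding R E0 (fun x => exists m, j m = x)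
    (fun x => x <> 0 /\ C x).
- split=> [|a _ _ [x <-] [y <-]]; first by exists 0; rewrite linear0.
  by exists (a *: x + y); rewrite linearP.
- by move=> _ [m <-] [m0 Cm]; apply: (CM _ Cm); split=> //; exists m.
have {}CM m : C (j m) -> j m = 0.
  by move=> Cm; apply: contrapT => m0; apply: (CM _ Cm); split=> //; exists m.
have {}DC x : D x -> C x -> x = 0.
  by move=> Dx Cx; apply: contrapT => x0; apply: (DC _ Dx).
pose incl : {linear submodule (submod_setP sD) -> E0} := @subincl _ _ _ (submod_setP sD).
have inclI : injective incl by exact: subincl_inj.
have inclP x : D (incl x) by apply/asboolP/(subinclP x).
have incl_surj y : D y -> exists x, incl x = y.
  by move=> Dy; apply: subincl_surj; apply/asboolP.
have [|i iE] := factor_inj (f := j) inclI.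
  by move=> m; apply/incl_surj/MD; exists m.
exists (submodule (submod_setP sD)), i; split.
- pose q : {linear E0 -> quomod (submod_setP sC)} := quoproj (submod_setP sC).
  have q0 x : q x = 0 <-> C x.
    by split=> [/quoproj_eq0/asboolP//|Cx]; apply/quoproj_eq0/asboolP.
  have [|g gE] := E0i _ _ (q \o incl : {linear _ -> _}) incl.
    apply: inj_eq0 => [|x /q0 Cx]; first exact: raddfB.
    by apply: inclI; rewrite linear0; apply: DC.
  (* The range of [g \o q] contains [D]. It meets [C] only in 0: the preimage of [C] contains [C]
     and meets [M] trivially, hence equals [C], which [q] kills. Maximality of [D] concludes. *)
  have gD x : D (g (q x)).
    apply: (Dmax (fun y => exists z, g (q z) = y)) => [|y Dy|_ [z <-] [z0 Cz]|]; last by exists x.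
    + split=> [|a _ _ [y <-] [z <-]]; first by exists 0; rewrite !linear0.
      by exists (a *: y + z); rewrite !linearP.
    + by have [e <-] := incl_surj _ Dy; exists (incl e); rewrite gE.
    + apply: z0; rewrite (_ : q z = 0) ?linear0 //; apply/q0.
      apply: (Cmax (fun y => C (g (q y)))) => [|y Cy|y Cy [y0 [m mE]]|] //.
      * split=> [|a x1 x2 C1 C2]; first by rewrite !linear0; apply sC.1.
        by rewrite !linearP; apply sC.2.
      * by rewrite (_ : q y = 0) ?linear0; [apply sC.1 | apply/q0].
      * apply: y0; move: Cy; rewrite -mE -iE (gE (i m)) => Cm.
        exact: DC.
  have [|r rE] := factor_inj (f := (g \o q : {linear E0 -> E0})) inclI.
    by move=> x; apply/incl_surj/gD.
  apply: (injective_retract (s := incl) (r := r)) => // e.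
  by apply: inclI; rewrite rE; apply: gE.
- by move=> m m' mm'; apply: jI; rewrite -!iE mm'.
- move=> A clA AM a Aa; apply: (inclI); rewrite linear0; apply: (DC) => //.
  (* Adding [A] to [C] keeps the intersection with [M] trivial, so maximality puts [A] inside [C],
     which meets [D] only in 0. *)
  apply: (Cmax (fun x => exists c b, [/\ C c, b \in A & x = c + incl b]))
    => [|c Cc|_ [c [b [Cc Ab ->]]] [cb0 [m mE]]|].
  + split=> [|d x y [c [b [Cc Ab ->]]] [c' [b' [Cc' Ab' ->]]]].
      by exists 0, 0; rewrite linear0 addr0; split=> //; [apply sC.1 | exact: clA.1].
    exists (d *: c + c'), (d *: b + b'); split; [exact: sC.2 | exact: clA.2 |].
    by rewrite linearP scalerDr addrACA.
  + by exists c, 0; rewrite linear0 addr0; split=> //; exact: clA.1.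
  + have cE : c = incl (i m - b) by rewrite linearB iE mE addrK.
    have c0 : c = 0 by apply: (DC); rewrite // cE.
    have mb : i m = b by apply: (inclI); rewrite iE mE c0 add0r.
    by apply: cb0; rewrite c0 add0r -mb AM ?linear0 ?mb.
  + by exists 0, a; rewrite add0r; split=> //; apply sC.1.
Qed.

End Envelope.

Section Presentations.
Variable S : pzRingType.

Lemma finitely_generatedP (M : lmodType S) : finitely_generated M <->
  exists n (p : {linear 'rV[S]_n -> M}), surjective p.
Proof.
split=> [[n [x xP]]|[n [p ps]]].
  have [c u v|p pE] := @linear_exists S 'rV[S]_n M (fun u => \sum_i u 0 i *: x i).
    rewrite scaler_sumr -big_split; apply: eq_bigr => i _.
    by rewrite !mxE scalerDl scalerA.
  exists n, p => y; have [c ->] := xP y; exists (\row_i c i).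
  by rewrite pE; apply: eq_bigr => i _; rewrite mxE.
exists n, (fun i => p (delta_mx 0 i)) => y; have [u <-] := ps y; exists (fun i => u 0 i).
by rewrite {1}(row_sum_delta u) linear_sum; apply: eq_bigr => i _; rewrite linearZ.
Qed.

Lemma finitely_presented_kernel (M : lmodType S) : finitely_presented M ->
  exists n (g : {linear 'rV[S]_n -> M}) (K : lmodType S) (i : {linear K -> 'rV[S]_n}),
    [/\ surjective g, exact_at i g, injective i & finitely_generated K].
Proof.
move=> [m [n [f [g [gs fg]]]]].
exists n, g, (submodule (kernel_closed g)), (kerincl g).
split=> //; first exact: kerincl_exact.
have [|p pE] := factor_inj (f := f) (@kerincl_inj _ _ _ g).
  by move=> x; apply/kerincl_exact/fg; exists x.
apply/finitely_generatedP; exists m, p => k.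
have /fg[x xE] : g (kerincl g k) = 0 by apply/kerincl_exact; exists k.
by exists x; apply: (@kerincl_inj _ _ _ g); rewrite pE.
Qed.

Lemma row_free_module n : free_module 'rV[S]_n.
Proof.
exists (fun b => exists l, b = delta_mx 0 l); split=> [x|s c us sB sc0 b bs].
  (* Coefficients are indexed by vectors, not by positions: pairing [b] with [x] returns the l-th
     entry of [x] when [b] is the l-th basis row. *)
  exists [seq delta_mx 0 l | l <- enum 'I_n], (fun b : 'rV[S]_n => \sum_l b 0 l * x 0 l).
  split=> [b /mapP[l _ ->]|]; first by exists l.
  rewrite big_map big_enum /= {1}(row_sum_delta x); apply: eq_bigr => l _.
  congr (_ *: _); rewrite (bigD1 l) //= big1 => [|k kl].
    by rewrite !mxE !eqxx mul1r addr0.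
  by rewrite !mxE eqxx (negPf kl) mul0r.
have [l bl] := sB b bs; have bl1 : b 0 l = 1 by rewrite bl mxE !eqxx.
have := congr1 (fun u : 'rV_n => u 0 l) sc0.
rewrite summxE (bigD1_seq b) //= !mxE bl1 mulr1 big_seq_cond big1 ?addr0 //.
move=> b' /andP[/sB[k ->] kb]; rewrite !mxE eqxx /=.
by have [lk|] := eqVneq l k; rewrite ?mulr0 //; rewrite bl lk eqxx in kb.
Qed.

(* A finitely generated submodule of a free module only involves finitely many
   basis vectors. *)
Lemma free_submodule_row (F K : lmodType S) (i : {linear K -> F}) :
  free_module F -> injective i -> finitely_generated K ->
  exists n (k : {linear K -> 'rV[S]_n}), injective k.
Proof.
move=> [B [Bspan Bfree]] iI [r [x xP]].
have /choice[sj sjP] (j : 'I_r) : exists s : seq F, (forall b, b \in s -> B b) /\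
    exists c : F -> S, i (x j) = \sum_(b <- s) c b *: b.
  by have [s [c [sB ->]]] := Bspan (i (x j)); exists s; split=> //; exists c.
pose s := undup (flatten [seq sj j | j <- enum 'I_r]).
have sB b : b \in s -> B b.
  by rewrite mem_undup => /flatten_mapP[j _ /(sjP j).1].
pose t l := tnth (in_tuple s) l.
have [a u v|h hE] := @linear_exists S 'rV[S]_(size s) F (fun u => \sum_l u 0 l *: t l).
  rewrite scaler_sumr -big_split; apply: eq_bigr => l _.
  by rewrite !mxE scalerDl scalerA.
have hI : injective h.
  apply: inj_eq0 => [|u]; first exact: raddfB.
  (* [c] reads [u] as a function of vectors through their position in [s]; outside [s] the index is
     out of range and the value is 0. *)
  pose c b := if insub (index b s) is Some l then u 0 l else 0.
  have cE l : c (t l) = u 0 l.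
    rewrite /c /t (tnth_nth 0) index_uniq ?undup_uniq ?ltn_ord //.
    by rewrite insubT ?ltn_ord // => lt; congr (u 0 _); apply: val_inj.
  rewrite hE => hu; apply/rowP => l; rewrite mxE -cE.
  apply: (Bfree s c); rewrite ?undup_uniq ?mem_tnth //.
  by rewrite big_tnth -[RHS]hu; apply: eq_bigr => k _; rewrite cE.
have [hr0 hrP] := range_closed h.
have hr b : b \in s -> exists u, h u = b.
  move=> /(tnthP (in_tuple s))[l ->]; exists (delta_mx 0 l).
  rewrite hE (bigD1 l) //= big1 => [|k kl].
    by rewrite !mxE !eqxx scale1r addr0.
  by rewrite !mxE eqxx (negPf kl) scale0r.
have rangeS I (q : seq I) (d : I -> S) (y : I -> F) :
    (forall e, exists u, h u = y e) -> exists u, h u = \sum_(e <- q) d e *: y e.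
  move=> /choice[w wE]; exists (\sum_(e <- q) d e *: w e).
  by rewrite linear_sum; apply: eq_bigr => e _; rewrite linearZ wE.
have [|k kE] := factor_inj (f := i) hI.
  move=> y; have [c ->] := xP y; rewrite linear_sum.
  under eq_bigr => j _ do rewrite linearZ.
  apply: (rangeS) => j; have [_ [d ->]] := sjP j.
  rewrite big_tnth; apply: rangeS => e; apply: hr.
  rewrite mem_undup; apply/flatten_mapP; exists j; rewrite ?mem_enum //.
  exact: mem_tnth.
by exists (size s), k => y z yz; apply: iI; rewrite -!kE yz.
Qed.

End Presentations.

(** * Projectivity of modules in F_1^fp, and the equivalences *)

Section Main.
Variable R : pzRingType.
Implicit Types (H K : lmodType R^c) (M N E : lmodType R).

(** Only quotients of R^m are tested: they are finitely generated, as needed for (1), and quotients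
    of an F_1^fp-flat module, as needed for (4). *)
Lemma F1fp_projective_criterion H : finitely_presented H ->
  (forall m (N : lmodType R) (q : {linear 'rV[R]_m -> N}), surjective q -> Tor1_eq0 H N) ->
  projective_module H.
Proof.
move=> /finitely_presented_kernel[n [g [K [i [gs ig iI Kfg]]]]] TorH.
apply: (projective_of_tensor_inj gs ig Kfg) => m N q qs.
exact: (Tor1_eq0_inj (@row_projective _ _) gs iI ig (TorH _ _ _ qs)).
Qed.

(** When [H] is flat, the kernel of a presentation is pure, so its inclusion stays injective after
    tensoring and splits. *)
Lemma fp_flat_projective H : finitely_presented H -> flat H -> projective_module H.
Proof.
move=> /finitely_presented_kernel[n [g [K [i [gs ig iI Kfg]]]]] /flat_char_flat Hf.
apply: (projective_of_tensor_inj gs ig Kfg) => m N q qs.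
exact: (char_flat_tensor_inj iI ig gs Hf).
Qed.

(* Tor_1(H, M) embeds in Tor_1(H, N) because the kernel K is flat. *)
Lemma tensor_inj_sub K H M N n (g : {linear 'rV[R^c]_n -> H})
    (i : {linear K -> 'rV[R^c]_n}) (j : {linear M -> N}) :
  surjective g -> injective i -> exact_at i g -> flat K -> injective j ->
  Tor1_eq0 H N -> injective (tensor_map i (@idfun M)).
Proof.
move=> gs iI ig Kf jI /(Tor1_eq0_inj (@row_projective _ _) gs iI ig) iN.
move=> x y /(congr1 (tensor_map (@idfun 'rV[R^c]_n) j)).
rewrite -!(tensor_map_comp (f'' := i) (g'' := j)) //.
rewrite !(tensor_map_comp (f := (@idfun K)) (g := j) (f' := i) (g' := (@idfun N))) //.
by move=> /iN/(Kf _ _ _ jI).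
Qed.

Lemma F1fp_projective_of_injectives :
  (forall M, injective_module M -> F1fp_flat M) ->
  forall H, F1fp H -> projective_module H.
Proof.
move=> Fflat H HF; have [/finitely_presented_kernel[n [g [K [i [gs ig iI Kfg]]]]] fd1] := HF.
apply: (projective_of_tensor_inj gs ig Kfg) => m N q qs.
have [E [j [Ei jI]]] := enough_injectives N.
have Kf := flat_dim_le1_kernel fd1 (@row_projective _ _) gs iI ig.
by apply: (tensor_inj_sub gs iI ig _ jI (Fflat _ Ei _ HF)); apply/flat_char_flat.
Qed.

(** [K] embeds in some R^n, and 0 -> K -> R^n is a flat resolution of the cokernel, which thus lies
    in F_1^fp and is projective. Hence [K] is a summand of R^n, presented by the complementary
    idempotent. *)
Lemma F1fp_coherent_of_projective :
  (forall H, F1fp H -> projective_module H) -> right_F1fp_coherent R.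
Proof.
move=> Fproj F K i Ffree iI Kfg Kf.
have [n [k kI]] := free_submodule_row Ffree iI Kfg.
have [r [p ps]] := (finitely_generatedP K).1 Kfg.
pose g : {linear 'rV[R^c]_n -> quomod (range_closed k)} := quoproj (range_closed k).
have gs : surjective g by exact: quoproj_surj.
have kg : exact_at k g.
  by move=> v; split=> [/quoproj_eq0/asboolP//|uv]; apply/quoproj_eq0/asboolP.
have [|s sE] := @projective_section _ _ _ g _ gs.
  apply: Fproj; split.
    exists r, n, (k \o p : {linear _ -> _}), g; split=> // v; split.
      by move=> /kg[y <-]; have [u <-] := ps y; exists u.
    by move=> [u <-]; apply/kg; exists (p u).
  exists K, 'rV[R^c]_n, k, g; split=> //.
  exact/flat_char_flat/projective_char_flat/row_projective.
have [|f fE] := factor_inj (f := (idfun \- (s \o g) : {linear 'rV[R^c]_n -> 'rV[R^c]_n})) kI.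
  by move=> v; apply/kg; rewrite /= linearB /= sE subrr.
have fk y : f (k y) = y.
  apply: kI; rewrite fE /= (_ : g (k y) = 0) ?linear0 ?addr0 //.
  by apply/kg; exists y.
exists n, n, (idfun \- (k \o f) : {linear 'rV[R^c]_n -> 'rV[R^c]_n}), f; split.
  by move=> y; exists (k y).
move=> v; split=> [fv|[u <-]]; last by rewrite linearB /= fk subrr.
by exists v; rewrite /= fv linear0 subr0.
Qed.

(** Take [L] maximal among submodules containing [N'] and missing [v]. Every nonzero submodule of
    R^m / L contains [q v], so the submodule [q v] generates is simple and essential. *)
Lemma subdirectly_irreducible_quotient m (N' : 'rV[R]_m -> Prop) (v : 'rV[R]_m) :
  submod_set N' -> ~ N' v ->
  exists M (q : {linear 'rV[R]_m -> M}) (S : lmodType R) (s : {linear S -> M}),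
    [/\ surjective q, forall x, N' x -> q x = 0, q v <> 0, simple_module S
      & injective s /\ essential s].
Proof.
move=> sN' N'v.
have [|L [sL N'L Lv Lmax]] := @maximal_avoiding R _ N' (fun x => x = v) sN'.
  by move=> x N'x xv; apply: N'v; rewrite -xv.
pose q : {linear 'rV[R]_m -> quomod (submod_setP sL)} := quoproj (submod_setP sL).
have qs : surjective q by exact: quoproj_surj.
have q0 x : q x = 0 <-> L x.
  by split=> [/quoproj_eq0/asboolP//|Lx]; apply/quoproj_eq0/asboolP.
have qv : q v <> 0 by move=> /q0/Lv; apply.
have sub_v (A : quomod (submod_setP sL) -> Prop) : submod_set A -> ~ A (q v) ->
    forall y, A y -> y = 0.
  move=> [A0 AP] Av y; have [x <-] := qs y => Ax; apply/q0.
  apply: (Lmax (fun x => A (q x))) => [|z /q0->|z Az zv|] //.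
    by split=> [|a z t]; rewrite ?linear0 // linearP; apply: AP.
  by apply: Av; rewrite -zv.
have clS : submod_set (fun y => exists a, y = a *: q v).
  split=> [|a _ _ [b ->] [c ->]]; first by exists 0; rewrite scale0r.
  by exists (a * b + c); rewrite scalerDl scalerA.
pose s : {linear submodule (submod_setP clS) -> _} := @subincl _ _ _ (submod_setP clS).
have sI : injective s by exact: subincl_inj.
have [e eE] : exists e, s e = q v.
  by apply: subincl_surj; apply/asboolP; exists 1; rewrite scale1r.
have spanS x : exists a, x = a *: e.
  have /asboolP[a aE] := subinclP x.
  by exists a; apply: sI; rewrite linearZ eE; exact: aE.
exists (quomod (submod_setP sL)), q, (submodule (submod_setP clS)), s; split=> //.
- by move=> x /N'L/q0.
- split; first by exists e; apply/eqP => e0; apply: qv; rewrite -eE e0 linear0.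
  move=> A [A0 AP]; have [Ae|Ae] := boolP (e \in A); [right=> x|left=> x Ax].
    by have [a ->] := spanS x; rewrite -[_ *: _]addr0; apply: AP.
  apply: (sI); rewrite linear0; apply: (sub_v (fun y => exists2 a, a \in A & s a = y)).
  + split=> [|c _ _ [y Ay <-] [z Az <-]]; first by exists 0; rewrite ?linear0.
    by exists (c *: y + z); [apply: AP | rewrite linearP].
  + move=> [a Aa sa]; have ae : a = e by apply: (sI); rewrite eE.
    by rewrite -ae Aa in Ae.
  + by exists x.
- split=> // A [A0 AP] AS y Ay; apply: (sub_v (fun y => y \in A)) => //.
  by move=> Av; apply: qv; rewrite -eE; apply: AS; rewrite eE.
Qed.

(* With K the finitely generated projective kernel of R^n -> H and phi_j a dual
   basis of K, Tor_1(H, M) is Hom(T, M) for T the cokernel of (R^n)^* -> K^*.  If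
   some phi_l is not in the image, the submodule generated by its class in a
   suitable quotient M of T is simple and essential, and sum_j k_j (x) phi_j is a
   nonzero element of Tor_1(H, M), which embeds in Tor_1(H, E(S)). *)
Lemma F1fp_projective_of_simples :
  right_F1fp_coherent R ->
  (forall (S E : lmodType R) (i : {linear S -> E}),
     simple_module S -> injective_envelope i -> F1fp_flat E) ->
  forall H, F1fp H -> projective_module H.
Proof.
move=> coh Eflat H HF.
have [/finitely_presented_kernel[n [g [K [i [gs ig iI Kfg]]]]] fd1] := HF.
have Kf : flat K.
  by apply/flat_char_flat/(flat_dim_le1_kernel fd1 (@row_projective _ _) gs iI ig).
have Kp : projective_module K.
  exact/fp_flat_projective/Kf/(coh _ _ i (@row_free_module _ _) iI).
have [m [p ps]] := (finitely_generatedP K).1 Kfg.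
have [s sE] := projective_section Kp ps.
pose k j := p (delta_mx 0 j); pose phi j y : R := s y 0 j.
have kE y : y = \sum_j (phi j y : R^c) *: k j.
  rewrite -{1}(sE y) (row_sum_delta (s y)) linear_sum.
  by apply: eq_bigr => j _; rewrite linearZ.
have phiP j (a : R) y z : phi j ((a : R^c) *: y + z) = phi j y * a + phi j z.
  by rewrite /phi linearP !mxE.
have coordP' l (a : R) y z : (i ((a : R^c) *: y + z) 0 l : R) = (i y 0 l : R) * a + (i z 0 l : R).
  by rewrite linearP !mxE.
(* Dual basis expansion: the [phi j] generate the left module of linear functionals on [K]. *)
have fsum (f : K -> R) : (forall (a : R) y z, f ((a : R^c) *: y + z) = f y * a + f z) ->
    forall y, f y = \sum_j f (k j) * phi j y.
  move=> fP y; have f0 : f 0 = 0.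
    by apply: (addrI (f 0)); have := fP 1 0 0; rewrite scaler0 !addr0 mulr1 => <-.
  rewrite {1}(kE y); elim: (index_enum _) => [|j r IH]; first by rewrite !big_nil.
  by rewrite !big_cons fP IH.
(* [N'] collects the rows [c] for which the functional sum_j c_j phi_j extends along [i] to R^n, so
   that R^m / N' is the cokernel T. *)
pose N' (c : 'rV[R]_m) := exists d : 'rV[R]_n, forall y,
  \sum_j c 0 j * phi j y = \sum_l d 0 l * (i y 0 l : R).
have sN' : submod_set N'.
  split=> [|a c c' [d dE] [d' d'E]].
    by exists 0 => y; rewrite !big1 // => j _; rewrite mxE mul0r.
  exists (a *: d + d') => y.
  have lin t (u u' : 'rV[R]_t) (w : 'I_t -> R) : \sum_j (a *: u + u') 0 j * w j =
      a * (\sum_j u 0 j * w j) + \sum_j u' 0 j * w j.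
    rewrite mulr_sumr -big_split; apply: eq_bigr => j _.
    by rewrite !mxE mulrDl mulrA.
  by rewrite (lin _ _ _ (fun j => phi j y)) dE d'E -lin.
have N'phi l : N' (delta_mx 0 l).
  apply: contrapT => /(subdirectly_irreducible_quotient sN').
  move=> [M [q [S [t [qs qN' ql Ssimple [tI te]]]]]]; apply: ql.
  have [E [h [Ei hI he]]] := injective_envelope_exists M.
  have TorE : Tor1_eq0 H E.
    apply: (Eflat S E (h \o t : {linear S -> E}) Ssimple) HF; split=> //.
      exact: inj_comp.
    exact: essential_comp.
  have iM := tensor_inj_sub gs iI ig Kf hI TorE.
  have x0 : \sum_j tens (k j) (q (delta_mx 0 j)) = 0.
    apply: iM; rewrite (zmod_morphism0 (@tensor_mapB _ _ _ _ _ _ _)) tensor_map_row_sum.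
    rewrite big1 // => r _; rewrite qN' ?tens0r //; exists (delta_mx 0 r) => y.
    rewrite [RHS](bigD1 r) //= [X in _ + X]big1 => [|r' /negPf r'r]; last first.
      by rewrite mxE r'r mul0r.
    rewrite mxE !eqxx mul1r addr0 (fsum (fun y => i y 0 r : R)) //.
    by apply: eq_bigr => j _; rewrite mxE.
  (* Contraction with [phi l] sends the element of K (x) M just shown to vanish to the image under
     [q] of the row of all phi_l(k_j). *)
  have b_bal : balanced (fun y (z : M) => phi l y *: z).
    split=> [y y' z|y z z'|a y z]; rewrite ?scalerDr //.
      by rewrite /phi linearD mxE scalerDl.
    by rewrite /phi linearZ mxE scalerA.
  have qphi : q (\row_j phi l (k j)) = 0.
    have := zmod_morphism0 (tensor_lift_zmod_morphism b_bal); rewrite -x0.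
    rewrite (zmod_morphism_sum _ _ (tensor_lift_zmod_morphism b_bal)) => <-.
    rewrite [\row_j _]row_sum_delta linear_sum; apply: eq_bigr => j _.
    by rewrite (tensor_lift_tens b_bal) linearZ mxE.
  (* This row and the l-th basis row both represent [phi l], so their difference is in [N'], with
     the zero functional as witness. *)
  rewrite -[delta_mx 0 l](subrK (\row_j phi l (k j))) linearD qphi addr0.
  apply: qN'; exists 0 => y; rewrite [RHS]big1 => [|j _]; last by rewrite mxE mul0r.
  under eq_bigr => j _ do rewrite !mxE mulrBl.
  rewrite sumrB -(fsum (phi l)) // (bigD1 l) //= big1 => [|j /negPf jl].
    by rewrite !eqxx mul1r addr0 subrr.
  by rewrite jl mul0r.
have /choice[d dE] := N'phi.
have phiE l y : phi l y = \sum_r d l 0 r * (i y 0 r : R).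
  rewrite -dE (bigD1 l) //= big1 => [|j /negPf jl]; first by rewrite mxE !eqxx mul1r addr0.
  by rewrite mxE jl mul0r.
have [a u v|f fE] := @linear_exists R^c 'rV[R^c]_n K
    (fun u => \sum_l ((\sum_r d l 0 r * (u 0 r : R) : R) : R^c) *: k l).
  rewrite scaler_sumr -big_split; apply: eq_bigr => l _ /=.
  rewrite scalerA -scalerDl; congr (_ *: _).
  rewrite -[RHS]/((\sum_r d l 0 r * (u 0 r : R)) * (a : R) + \sum_r d l 0 r * (v 0 r : R)).
  rewrite mulr_suml -big_split; apply: eq_bigr => r _.
  by rewrite !mxE mulrDr mulrA.
apply: (projective_of_retraction (f := f) (@row_projective _ _) gs ig) => y.
by rewrite fE [RHS]kE; apply: eq_bigr => l _; rewrite phiE.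
Qed.

End Main.

Theorem theorem3p12 (R : pzRingType) :
  [<-> (forall M : lmodType R, finitely_generated M -> F1fp_flat M);
       (forall M : lmodType R, F1fp_flat M);
       (forall M : lmodType R, injective_module M -> F1fp_flat M);
       (forall (M N : lmodType R) (q : {linear M -> N}),
          surjective q -> F1fp_flat M -> F1fp_flat N);
       (right_F1fp_coherent R /\
        forall (S E : lmodType R) (i : {linear S -> E}),
          simple_module S -> injective_envelope i -> F1fp_flat E);
       (forall H : lmodType R^c, F1fp H -> projective_module H)].
Proof.
(* That (6) implies (2) is proved first, since several of the arrows below pass through (6). *)
have projective_flat : (forall H : lmodType R^c, F1fp H -> projective_module H) ->
    forall M : lmodType R, F1fp_flat M.
  by move=> Fproj M H /Fproj/projective_Tor1_eq0.
tfae.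
- move=> fg_flat; apply: projective_flat => H HF.
  apply: (F1fp_projective_criterion HF.1) => m N q qs; apply: (fg_flat) HF.
  by apply/finitely_generatedP; exists m, q.
- by [].
- by move=> /F1fp_projective_of_injectives/projective_flat flatM M N q _ _.
- move=> quo_flat.
  have Fproj (H : lmodType R^c) : F1fp H -> projective_module H.
    move=> HF; apply: (F1fp_projective_criterion HF.1) => m N q qs.
    by apply: (quo_flat _ _ q qs) HF => H' _; apply: row_Tor1_eq0.
  split; first exact: F1fp_coherent_of_projective.
  by move=> S E i _ _; apply: projective_flat.
- by move=> [coh Eflat]; apply: F1fp_projective_of_simples.
- by move=> /projective_flat flatM M _.
Qed.
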